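(* Let $\Phi$ be a locally convex space, let $\Psi$ be a locally convex space equipped with a multi-Hilbertian topology, and let $X=(X_{t}: t \geq 0)$ be a cylindrical process in $\Psi'$ satisfying: (1) For each $\psi \in \Psi$, the real-valued process $X(\psi)=(X_{t}(\psi): t \geq 0)$ is continuous (respectively càdlàg). (2) For every $T>0$, the Fourier transforms of the family $(X_{t}: t \in [0,T])$ are equicontinuous at the origin on $\Psi$. Let $S$ be a Hilbert-Schmidt operator from $\Phi$ into $\Psi$. Then there exist a countably Hilbertian topology $\vartheta$ on $\Phi$ and a $(\widetilde{\Phi_{\vartheta}})'$-valued continuous (respectively càdlàg) process $Y=(Y_{t}: t \geq 0)$ such that for every $\phi \in \Phi$, $\langle Y,\phi\rangle=(\langle Y_{t},\phi\rangle: t \geq 0)$ is a version of $X\circ S(\phi)=(X_{t}\circ S(\phi): t \geq 0)$. Moreover, $Y$ is a $\Phi'$-valued, regular, continuous (respectively càdlàg) version of $X\circ S$ that is unique up to indistinguishable versions.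
   Context: All vector spaces are over $\mathbb{R}$. $(\Omega,\mathscr{F},\mathbb{P})$ is a complete probability space, and $L^{0}(\Omega,\mathscr{F},\mathbb{P})$ is the space of equivalence classes of real random variables with the topology of convergence in probability. For a locally convex space $(\Phi,\tau)$, the topological dual $\Phi'$ carries the strong topology (as do all duals); $\langle f,\phi\rangle$ is the canonical pairing. Seminorms. A continuous seminorm $p$ on $\Phi$ is Hilbertian if $p(\phi)^{2}=Q(\phi,\phi)$ for a symmetric non-negative bilinear form $Q$. $\Phi_{p}$ denotes the completion of $\Phi/\ker(p)$ under the norm induced by $p$, $i_{p}:\Phi\to\Phi_{p}$ the canonical map; $p$ is separable if $\Phi_{p}$ is separable. A topology is multi-Hilbertian if it is generated by a family of separable Hilbertian seminorms. Hilbert-Schmidt operators. A linear operator $S:\Phi\to\Psi$ between locally convex spaces is a Hilbert-Schmidt operator if there exist a continuous Hilbertian seminorm $p$ on $\Phi$ and a bounded, convex, balanced subset $B$ of $\Psi$ such that $\Psi_{B}=\bigcup_{n\in\mathbb{N}}nB$ equipped with the norm $p_{B}(\psi)=\inf\{\lambda>0:\psi\in\lambda B\}$ is a Hilbert space, $S(\{\phi: p(\phi)\leq 1\})\subseteq B$, and the induced operator $S_{0}\in\mathcal{L}(\Phi_{p},\Psi_{B})$ (with $S=j_{B}\circ S_{0}\circ i_{p}$, $j_{B}:\Psi_{B}\to\Psi$ the inclusion) is Hilbert-Schmidt. Countably Hilbertian topology. A (weaker) countably Hilbertian topology $\vartheta$ on $\Phi$ is a locally convex topology generated by an increasing sequence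 $(q_{n})$ of separable continuous Hilbertian seminorms on $(\Phi,\tau)$. $\Phi_{\vartheta}=(\Phi,\vartheta)$ and $\widetilde{\Phi_{\vartheta}}$ is its (not necessarily Hausdorff) completion; as sets $(\widetilde{\Phi_{\vartheta}})'=\bigcup_{n}\Phi'_{q_{n}}\subseteq\Phi'$, with linear continuous inclusion into $\Phi'$. Cylindrical objects. A cylindrical random variable in $\Phi'$ is a linear map $X:\Phi\to L^{0}(\Omega,\mathscr{F},\mathbb{P})$; its Fourier transform is $\phi\mapsto\mathbb{E}(e^{iX(\phi)})$. A cylindrical process in $\Phi'$ is a family $(X_{t})$ of cylindrical random variables in $\Phi'$ (same for $\Psi'$). If $X$ is a cylindrical process in $\Psi'$ and $S:\Phi\to\Psi$ is linear, $X\circ S=(X_{t}\circ S)$ is a cylindrical process in $\Phi'$. A $\Phi'$-valued random variable is an $\mathscr{F}/\mathcal{B}(\Phi')$-measurable map. A process is continuous (càdlàg) if for $\mathbb{P}$-a.e. $\omega$ its path is continuous (right-continuous with left limits); since $X_{t}(\psi)$ is an equivalence class, pathwise statements about $X(\psi)$ refer to a version of it. A $\Phi'$-valued process $Y$ is a version of a cylindrical process $X$ in $\Phi'$ if for all $t$ and $\phi$, $\langle Y_{t},\phi\rangle=X_{t}(\phi)$ $\mathbb{P}$-a.e. A $\Phi'$-valued process $Y$ is regular if for each $t$ there is a weaker countably Hilbertian topology $\theta$ on $\Phi$ with $\mathbb{P}(Y_{t}\in(\widetilde{\Phi_{\theta}})')=1$. Uniqueness up to indistinguishable versions: any two $\Phi'$-valued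 processes $Y,Z$ with the stated properties satisfy $\mathbb{P}(Y_{t}=Z_{t}\ \forall t\geq 0)=1$. *)

(* Defs.v *)
From HB Require Import structures.
From mathcomp Require Import all_boot all_order all_algebra sesquilinear.
From mathcomp Require Import complex.
From mathcomp Require Import all_classical all_reals all_analysis.

Set Implicit Arguments.
Unset Strict Implicit.
Unset Printing Implicit Defensive.
Import Order.TTheory GRing.Theory Num.Theory.
Import numFieldNormedType.Exports.
Local Open Scope classical_set_scope.
Local Open Scope ring_scope.

#[short(type="linearContinuousType")]
HB.structure Definition LinearContinuous (R : numDomainType) (E F : tvsType R) :=
  {f of @Continuous E F f & @GRing.Linear R E F *:%R f}.

Notation "{ 'linear_continuous' E -> F }" := (@linearContinuousType _ E F)
  (at level 0, E at level 98, F at level 99,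
   format "{ 'linear_continuous'  E  ->  F }") : type_scope.

HB.instance Definition _ (R : numDomainType) (E F : tvsType R) :=
  gen_eqMixin {linear_continuous E -> F}.
HB.instance Definition _ (R : numDomainType) (E F : tvsType R) :=
  gen_choiceMixin {linear_continuous E -> F}.

Section composition.
Context (R : numDomainType) (E F G : tvsType R).
Context (f : {linear_continuous E -> F}) (g : {linear_continuous F -> G}).
#[warning="-HB.no-new-instance"]
HB.instance Definition _ := GRing.Linear.on (g \o f).
End composition.

Section dual.
Context (R : realType).
Implicit Types E F : tvsType R.

Definition tvs_bounded E (B : set E) : Prop :=
  forall U, nbhs 0 U -> exists2 r : R, 0 < r & B `<=` *:%R r @` U.

(* The topology of uniform convergence on the bounded subsets of [E]. *)
Definition strong_dual E : Type :=
  initial_topology (fun f : {linear_continuous E -> R^o} =>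
    (f : E -> R^o) : {family @tvs_bounded E, E -> R^o}).

HB.instance Definition _ E := Uniform.on (strong_dual E).

Definition pairing E (f : strong_dual E) : E -> R :=
  (f : {linear_continuous E -> R^o}).

Definition adjoint E F (j : {linear_continuous E -> F}) (f : strong_dual F) :
    strong_dual E :=
  (f : {linear_continuous F -> R^o}) \o j : {linear_continuous E -> R^o}.

End dual.

(* Completions, and the normed space spanned by a bounded disc, are given below
   by their defining properties, which determine them up to isometric
   (respectively, for locally convex completions, topological) isomorphism, once
   the indistinguishable points of a non-Hausdorff completion are identified. *)

Section hilbert.
Context (R : realType).

Definition inner_product (H : normedModType R) (Q : {symmetric H}) : Prop :=
  forall x, Q x x = `|x| ^+ 2.

Definition hilbert_space (H : completeNormedModType R) : Prop :=
  exists Q : {symmetric H}, inner_product Q.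

Definition linear_span (V : lmodType R) (A : set V) : set V :=
  [set v | exists n (a : 'I_n -> R) (x : 'I_n -> V),
     (forall i, A (x i)) /\ v = \sum_(i < n) a i *: x i].

Definition orthonormal_basis (H : completeNormedModType R) (A : set H) : Prop :=
  exists Q : {symmetric H}, [/\ inner_product Q,
    forall x y, A x -> A y -> Q x y = (x == y)%:R &
    dense (linear_span A)].

(* Whether the sum is finite does not depend on the orthonormal basis, and every
   Hilbert space has one. *)
Definition hilbert_schmidt (H K : completeNormedModType R)
    (S0 : {linear_continuous H -> K}) : Prop :=
  exists2 A : set H, orthonormal_basis A &
    (\esum_(x in A) (`|S0 x| ^+ 2)%:E < +oo)%E.

End hilbert.

Section seminorms.
Context (R : realType) (Phi : tvsType R).
Implicit Types (p : Phi -> R) (B : set Phi) (theta : set_system Phi).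

Definition hilbertian_seminorm p : Prop :=
  [/\ continuous (p : Phi -> R^o), forall phi, 0 <= p phi,
      forall a phi, p (a *: phi) = `|a| * p phi,
      forall phi psi, p (phi + psi) <= p phi + p psi &
      exists2 Q : {symmetric Phi}, forall phi, 0 <= Q phi phi &
        forall phi, p phi ^+ 2 = Q phi phi].

(* [H], with the canonical map [i], is the completion of Phi / ker p. *)
Definition seminorm_completion p (H : completeNormedModType R)
    (i : {linear Phi -> H}) : Prop :=
  (forall phi, `|i phi| = p phi) /\ dense (range i).

Definition separable_seminorm p : Prop :=
  exists (H : completeNormedModType R) (i : {linear Phi -> H}),
    seminorm_completion p i /\ exists2 D : set H, countable D & dense D.

(* The filter of neighbourhoods of 0 of the locally convex topology generated
   by the seminorms in [F]. *)
Definition seminorm_nbhs0 (F : set (Phi -> R)) : set_system Phi :=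
  [set U | exists n (p : 'I_n -> Phi -> R) (e : R),
     [/\ forall i, F (p i), 0 < e &
         [set phi | forall i, p i phi < e] `<=` U]].

Definition multi_hilbertian : Prop :=
  exists2 F : set (Phi -> R),
    forall p, F p -> hilbertian_seminorm p /\ separable_seminorm p &
    nbhs (0 : Phi) = seminorm_nbhs0 F.

(* A locally convex topology on Phi other than its given one is represented by
   its filter [theta] of neighbourhoods of 0. *)
Definition countably_hilbertian theta : Prop :=
  exists q : nat -> Phi -> R,
    [/\ forall n, hilbertian_seminorm (q n) /\ separable_seminorm (q n),
        forall phi, nondecreasing_seq (q ^~ phi) &
        theta = seminorm_nbhs0 (range q)].

Definition balanced B : Prop :=
  forall (a : R) x, `|a| <= 1 -> B x -> B (a *: x).

Definition gauge B (psi : Phi) : R :=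
  inf [set l : R | 0 < l /\ ( *:%R l @` B) psi].

(* [K] is the space Phi_B normed by the gauge of [B], and [jB] is its inclusion
   into Phi. *)
Definition disc_space B (K : normedModType R) (jB : {linear K -> Phi}) : Prop :=
  [/\ injective jB, range jB = \bigcup_n ( *:%R n%:R @` B) &
      forall x, `|x| = gauge B (jB x)].

End seminorms.

Definition hilbert_schmidt_operator (R : realType) (Phi Psi : tvsType R)
    (S : {linear Phi -> Psi}) : Prop :=
  exists (p : Phi -> R) (B : set Psi),
  [/\ hilbertian_seminorm p,
      [/\ tvs_bounded B, convex_set B & balanced B],
      S @` [set phi | p phi <= 1] `<=` B &
      exists (H K : completeNormedModType R)
        (ip : {linear Phi -> H}) (jB : {linear K -> Psi})
        (S0 : {linear_continuous H -> K}),
      [/\ seminorm_completion p ip, disc_space B jB, hilbert_space K,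
          forall phi, S phi = jB (S0 (ip phi)) & hilbert_schmidt S0]].

Section completion.
Context (R : realType).

(* Completeness is that of the uniformity induced by the vector space
   structure, to which the uniform structure of a [tvsType] is not tied. *)
Definition tvs_cauchy (E : tvsType R) (F : set_system E) : Prop :=
  forall U, nbhs 0 U -> exists2 A, F A & forall x y, A x -> A y -> U (x - y).

Definition tvs_complete (E : tvsType R) : Prop :=
  forall F : set_system E, ProperFilter F -> tvs_cauchy F ->
    exists x : E, F --> x.

Definition tvs_completion (Phi E : tvsType R) (theta : set_system Phi)
    (j : {linear_continuous Phi -> E}) : Prop :=
  [/\ tvs_complete E, dense (range j) &
      theta = [set U | exists2 V, nbhs (0 : E) V & j @^-1` V `<=` U]].

End completion.

Variant path_kind := Continuous_paths | Cadlag_paths.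

Section processes.
Context (R : realType) d (Omega : measurableType d) (P : probability Omega R).
Implicit Types (k : path_kind).

Definition path_of_kind k (T : topologicalType) (f : R -> T) : Prop :=
  match k with
  | Continuous_paths => {within [set t | 0 <= t], continuous f}
  | Cadlag_paths =>
      (forall t, 0 <= t -> f s @[s --> t^'+] --> f t) /\
      (forall t, 0 < t -> exists l : T, f s @[s --> t^'-] --> l)
  end.

Definition borel_measurable (T : topologicalType) (Y : Omega -> T) : Prop :=
  forall B : set T, <<s open >> B -> measurable (Y @^-1` B).

(* Processes are functions on R of which only the values at t >= 0 matter. *)
Definition process_of_kind k (T : topologicalType) (Y : R -> Omega -> T) : Prop :=
  (forall t, 0 <= t -> borel_measurable (Y t)) /\
  {ae P, forall w, path_of_kind k (Y ^~ w)}.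

Local Notation L0 := {mfun_ P, Omega >-> measurableTypeR R}.

Definition cylindrical_process (Phi : tvsType R) (X : R -> Phi -> L0) : Prop :=
  forall t, 0 <= t -> forall a phi psi,
    X t (a *: phi + psi) = (fun w => a * X t phi w + X t psi w) %[ae P].

(* X_t(psi) is an equivalence class: its path properties are those of some
   version. *)
Definition real_process_of_kind k (x : R -> L0) : Prop :=
  exists2 Z : R -> Omega -> R, process_of_kind k (Z : R -> Omega -> R^o) &
    forall t, 0 <= t -> Z t = x t %[ae P].

(* The expectation of exp (i X(phi)), by real and imaginary parts. *)
Definition fourier (Phi : tvsType R) (X : Phi -> L0) (phi : Phi) : R[i] :=
  Complex (\int[P]_w cos (X phi w)) (\int[P]_w sin (X phi w)).

Definition fourier_equicontinuous0 (Phi : tvsType R) (X : R -> Phi -> L0)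
    (I : set R) : Prop :=
  forall e : R, 0 < e -> \forall phi \near (0 : Phi),
    forall t, I t -> `|fourier (X t) phi - fourier (X t) 0| < e%:C%C.

Definition version_of (Phi : tvsType R) (Y : R -> Omega -> strong_dual Phi)
    (X : R -> Phi -> L0) : Prop :=
  forall t phi, 0 <= t -> (fun w => pairing (Y t w) phi) = X t phi %[ae P].

Definition regular_process (Phi : tvsType R)
    (Y : R -> Omega -> strong_dual Phi) : Prop :=
  forall t, 0 <= t -> exists theta, countably_hilbertian theta /\
    exists (E : tvsType R) (j : {linear_continuous Phi -> E}),
      tvs_completion theta j /\ {ae P, forall w, range (adjoint j) (Y t w)}.

Definition regular_version k (Phi : tvsType R) (X : R -> Phi -> L0)
    (Y : R -> Omega -> strong_dual Phi) : Prop :=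
  [/\ process_of_kind k Y, regular_process Y & version_of Y X].

Definition indistinguishable (T : Type) (Y Z : R -> Omega -> T) : Prop :=
  {ae P, forall w, forall t, 0 <= t -> Y t w = Z t w}.

End processes.

(* Main.v *)
Require Import Defs.
From HB Require Import structures.
From mathcomp Require Import all_boot all_order all_algebra sesquilinear.
From mathcomp Require Import complex.
From mathcomp Require Import all_classical all_reals all_analysis.
From mathcomp Require Import measurable_realfun.
From mathcomp Require Import ring lra.

Set Implicit Arguments.
Unset Strict Implicit.
Unset Printing Implicit Defensive.
Import Order.TTheory GRing.Theory Num.Theory.
Import numFieldNormedType.Exports.
Local Open Scope classical_set_scope.
Local Open Scope ring_scope.

(** The operator S factors as the map i_p to the Hilbert space H of a seminorm,
    a Hilbert-Schmidt operator S0 from H to the Hilbert space K of a bounded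
    disc, and the inclusion j_B of K. Let (e_k) be the countably many vectors
    of an orthonormal basis of H whose images x_k = S0 e_k do not vanish, so
    that the sum of the squared norms of the x_k is finite. The process is

      Y_t = sum_k X_t (j_B x_k) <., e_k>,

    with values in the closed span E of the e_k, identified with its dual. The
    projection of Phi to E is the completion of Phi for one separable
    Hilbertian seminorm (hilbert_schmidt_factorization and
    completion_of_dense_map), which generates the required topology. What has
    to be shown is that the series converges in E uniformly on bounded time
    intervals, for suitable versions of the processes X (j_B x_k).

    First, j_B is continuous and the Fourier transforms of X are continuous at
    the origin, so each X_t o j_B is continuous in probability on K
    (fourier_tail_bound, cylindrical_continuous). Since paths are bounded on
    bounded time intervals, Baire's theorem makes the supremum over a countable
    dense set of times continuous in probability too (equicontinuity).

    Second, this control is transferred from one vector to the sum of squares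
    of the coordinates by Rademacher averages: if at one time the sum of the
    X_t (j_B x_k) ^ 2 is large, then a fixed proportion of the signed sums of
    the X_t (j_B x_k) is large at the same time (paley_zygmund_signs); and these
    are the values of X_t at signed sums of the x_k, whose mean square norm is
    the sum of the squared norms. Thus the tails of the series are small in
    probability, uniformly in time (square_sum_equicontinuity). The
    Borel-Cantelli lemma yields almost sure convergence along blocks, and
    uniform limits preserve continuity and the cadlag property
    (block_sum_limit, regularized_process_exists). Pairing Y_t with a vector
    phi gives X_t (S phi) because the expansion of S0 converges in K and X_t is
    continuous in probability there.

    For uniqueness, at a fixed time two regular versions are almost surely
    continuous for countably Hilbertian topologies whose supremum is separable,
    so agreeing almost surely at each vector they agree almost surely
    (regular_variable_ext). Right continuity passes from rational times to all
    times (indistinguishable_of_ae_eq). *)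

(** * Symmetric forms, series and dense sets *)

Section form.
Context (R : realType) (V : lmodType R) (Q : {symmetric V}).
Implicit Types x y z : V.

Lemma formC x y : Q x y = Q y x.
Proof. by rewrite (hermC Q) expr0 mul1r. Qed.

Lemma form_suml (I : Type) (r : seq I) (p : pred I) (f : I -> V) y :
  Q (\sum_(i <- r | p i) f i) y = \sum_(i <- r | p i) Q (f i) y.
Proof.
by apply: (big_morph (Q^~ y)) => [u v|]; [rewrite linearDl|rewrite linear0l].
Qed.

Lemma form_sumr (I : Type) (r : seq I) (p : pred I) (f : I -> V) y :
  Q y (\sum_(i <- r | p i) f i) = \sum_(i <- r | p i) Q y (f i).
Proof. by rewrite formC form_suml; apply: eq_bigr => i _; rewrite formC. Qed.

Lemma formZl a x y : Q (a *: x) y = a * Q x y.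
Proof. by rewrite linearZl. Qed.

Lemma formZr a x y : Q x (a *: y) = a * Q x y.
Proof. by rewrite formC formZl formC. Qed.

Lemma form_sqrD x y : Q (x + y) (x + y) = Q x x + 2 * Q x y + Q y y.
Proof. by rewrite linearDl !linearDr/= (formC y x); ring. Qed.

Lemma form_sqrB x y : Q (x - y) (x - y) = Q x x - 2 * Q x y + Q y y.
Proof. by rewrite form_sqrD -scaleN1r !formZl !formZr; ring. Qed.

End form.

Section summation.
Context {R : realType}.

(** A partial sum within e of the supremum of all of them leaves less than e
    for everything after it. *)
Lemma bounded_series_tail (a : nat -> R) (C : R) :
  (forall k, 0 <= a k) -> (forall n, \sum_(0 <= k < n) a k <= C) ->
  forall e : R, 0 < e -> exists N, forall m n, (N <= m)%N -> (m <= n)%N ->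
    \sum_(m <= k < n) a k < e.
Proof.
move=> a0 aC e e0.
pose A : set R := range (fun n => \sum_(0 <= k < n) a k).
have supA : has_sup A.
  by split; [exists (\sum_(0 <= k < 0) a k), 0%N|exists C => _ [n _ <-]].
have [_ [N _ <-] AN] := sup_adherent e0 supA.
exists N => m n Nm mn.
have : \sum_(0 <= k < n) a k <= sup A by apply: sup_ubound; [exact: supA.2|exists n].
rewrite (big_cat_nat (n := m))//= (big_cat_nat (m := 0%N) (n := N) (p := m))//=.
have : 0 <= \sum_(N <= i < m) a i by apply: sumr_ge0.
lra.
Qed.

Lemma cauchy_seq_cvg (V : completeNormedModType R) (u : nat -> V) :
  (forall e : R, 0 < e ->
    exists N, forall m n, (N <= m)%N -> (m <= n)%N -> `|u n - u m| < e) ->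
  cvgn u.
Proof.
move=> uC; apply/cauchy_cvgP/cauchy_exP => e e0.
have [N uN] := uC _ e0; exists (u N), N => // n /= Nn.
by rewrite -ball_normE/= distrC; exact: uN.
Qed.

End summation.

Lemma dense_normP (R : realType) (H : normedModType R) (A : set H) : dense A ->
  forall (h : H) (r : R), 0 < r -> exists2 z, A z & `|h - z| < r.
Proof.
move=> Ad h r r0.
have [||z [hz Az]] := Ad (ball h r).
- by exists h; exact: ballxx.
- exact: ball_open.
- by exists z => //; rewrite -ball_normE in hz.
Qed.


(** * Orthogonal projections in Hilbert spaces *)

Section inner_product.
Context (R : realType) (H : normedModType R) (Q : {symmetric H}).
Hypothesis QE : inner_product Q.

Lemma inner_product_Cauchy_Schwarz x y : `|Q x y| <= `|x| * `|y|.
Proof.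
have [->|y0] := eqVneq y 0; first by rewrite linear0r normr0 mulr_ge0.
have y2 : 0 < `|y| ^+ 2 by rewrite exprn_gt0// normr_gt0.
rewrite -(@ler_pXn2r _ 2)// ?nnegrE ?mulr_ge0// exprMn real_normK ?num_real//.
have := sqr_ge0 `| `|y| ^+ 2 *: x - Q x y *: y|.
rewrite -(QE (_ - _)) form_sqrB !formZl !formZr !QE.
rewrite (_ : _ + _ = `|y| ^+ 2 * (`|y| ^+ 2 * `|x| ^+ 2 - Q x y ^+ 2)); last by ring.
rewrite pmulr_rge0// subr_ge0; lra.
Qed.

Lemma inner_product_continuous y : continuous (fun x => Q x y).
Proof.
move=> x; apply/cvgrPdist_le => e e0.
have y1 : 0 < `|y| + 1 by rewrite ltr_wpDl.
near=> z; rewrite -linearBl/=.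
rewrite (le_trans (inner_product_Cauchy_Schwarz _ _))//.
rewrite (@le_trans _ _ (e / (`|y| + 1) * `|y|))//.
  rewrite ler_wpM2r//; near: z.
  by apply: cvgr_dist_le; [exact: cvg_id|exact: divr_gt0].
by rewrite -mulrAC ler_pdivrMr// ler_pM2l// lerDl.
Unshelve. all: by end_near. Qed.

Context (e : nat -> H).
Hypothesis e_orth : forall i j, i != j -> Q (e i) (e j) = 0.
Hypothesis e_unit : forall i, e i = 0 \/ `|e i| = 1.

Lemma normsq_orthogonal_sum (c : nat -> R) m n :
  `|\sum_(m <= k < n) c k *: e k| ^+ 2 = \sum_(m <= k < n) (c k * `|e k|) ^+ 2.
Proof.
rewrite -QE; elim: n => [|n IH]; first by rewrite !big_geq// linear0l.
have [mn|mn] := leqP m n; last by rewrite !big_geq// linear0l.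
have Qe0 : Q (\sum_(m <= k < n) c k *: e k) (e n) = 0.
  rewrite form_suml big_nat big1// => i /andP[_ ni].
  by rewrite formZl e_orth ?mulr0// ltn_eqF.
by rewrite !big_nat_recr//= form_sqrD IH !formZr formZl QE Qe0; ring.
Qed.

Lemma orthogonal_sum_le (c : nat -> R) m n :
  `|\sum_(m <= k < n) c k *: e k| ^+ 2 <= \sum_(m <= k < n) c k ^+ 2.
Proof.
rewrite normsq_orthogonal_sum; apply: ler_sum => k _.
by have [->|->] := e_unit k; rewrite ?normr0 ?mulr0 ?expr0n ?mulr1 ?sqr_ge0.
Qed.

Lemma form_orthogonal_sum (c : nat -> R) n i : (i < n)%N ->
  Q (\sum_(0 <= k < n) c k *: e k) (e i) = c i * `|e i| ^+ 2.
Proof.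
move=> ni; rewrite form_suml big_mkord (bigD1 (Ordinal ni))//= big1 ?addr0.
  by rewrite formZl QE.
by move=> j ji; rewrite formZl e_orth ?mulr0.
Qed.

(** The coefficient on a vanishing e i is 0, so the vectors e i may be padded
    with zeros without any case distinction later. *)
Lemma form_unit x i : Q x (e i) * `|e i| = Q x (e i).
Proof. by case: (e_unit i) => ei; rewrite ei ?mulr1// linear0r mul0r. Qed.

(** The difference of x and its partial expansion has a nonnegative square
    norm, which is the difference of the two sides. *)
Lemma bessel x n : \sum_(0 <= k < n) Q x (e k) ^+ 2 <= `|x| ^+ 2.
Proof.
have := sqr_ge0 `|x - \sum_(0 <= k < n) Q x (e k) *: e k|.
rewrite -(QE (_ - _)) form_sqrB !QE normsq_orthogonal_sum form_sumr.
under [in X in _ - 2 * X]eq_bigr do rewrite formZr -expr2.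
under [X in _ + X]eq_bigr do rewrite form_unit.
lra.
Qed.

End inner_product.

Section projection.
Context (R : realType) (H : completeNormedModType R) (Q : {symmetric H}).
Hypothesis QE : inner_product Q.
Context (e : nat -> H).
Hypothesis e_orth : forall i j, i != j -> Q (e i) (e j) = 0.
Hypothesis e_unit : forall i, e i = 0 \/ `|e i| = 1.

(** The partial sums always converge for an orthonormal family padded with
    zeros, by Bessel's inequality; this is then the orthogonal projection on
    the closed span of the family. *)
Definition orth_proj (x : H) : H :=
  limn (fun n => \sum_(0 <= k < n) Q x (e k) *: e k).

Lemma orth_proj_cvg x :
  (fun n => \sum_(0 <= k < n) Q x (e k) *: e k) @ \oo --> orth_proj x.
Proof.
apply: cauchy_seq_cvg => r r0.
have [|N hN] := bounded_series_tail _ (bessel QE e_orth e_unit x)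
  (exprn_gt0 2 r0).
  by move=> k; exact: sqr_ge0.
exists N => m n Nm mn; rewrite (big_cat_nat (n := m) (p := n))//= addrAC subrr add0r.
rewrite -(@ltr_pXn2r _ 2)// ?nnegrE// ?ltW//.
exact: le_lt_trans (orthogonal_sum_le QE e_orth e_unit _ _ _) (hN _ _ Nm mn).
Qed.

Lemma orth_proj_linear : linear orth_proj.
Proof.
move=> a x y; apply: cvg_lim => //.
rewrite (_ : (fun _ => _) = (fun n => a *: \sum_(0 <= k < n) Q x (e k) *: e k
   + \sum_(0 <= k < n) Q y (e k) *: e k)); last first.
  apply/funext => n; rewrite scaler_sumr -big_split/=; apply: eq_bigr => k _.
  by rewrite linearDl/= formZl scalerDl scalerA.
by apply: cvgD; [apply: cvgZr|]; exact: orth_proj_cvg.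
Qed.

Lemma orth_proj_form x k : Q (orth_proj x) (e k) = Q x (e k).
Proof.
have : (fun n => Q (\sum_(0 <= k < n) Q x (e k) *: e k) (e k)) @ \oo
    --> Q (orth_proj x) (e k).
  have := @inner_product_continuous _ _ _ QE (e k) (orth_proj x).
  exact: cvg_comp (@orth_proj_cvg x).
move/cvg_lim => <-//; apply: lim_near_cst => //.
exists k.+1 => // n /= kn; rewrite form_orthogonal_sum// expr2 mulrA.
by rewrite !form_unit.
Qed.

Lemma orth_proj_norm x : `|orth_proj x| <= `|x|.
Proof.
have h := cvg_norm (@orth_proj_cvg x).
rewrite -(cvg_lim _ (h _))//; apply: limr_le; first
  by apply/cvg_ex; exists `|orth_proj x|; exact: h.
apply: nearW => n.
rewrite -(@ler_pXn2r _ 2)// ?nnegrE//.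
exact: le_trans (orthogonal_sum_le QE e_orth e_unit _ _ _)
  (bessel QE e_orth e_unit _ _).
Qed.

Lemma orth_proj_basis m : orth_proj (e m) = e m.
Proof.
apply: cvg_lim => //; apply: cvg_near_cst; exists m.+1 => // n /= mn.
rewrite big_mkord (bigD1 (Ordinal mn))//= big1 ?addr0 => [|j jm]; last first.
  by rewrite e_orth ?scale0r// eq_sym.
rewrite QE; have [->|->] := e_unit m; first by rewrite scaler0.
by rewrite expr1n scale1r.
Qed.

Lemma orth_projK x : orth_proj (orth_proj x) = orth_proj x.
Proof.
congr (limn _); apply/funext => n; apply: eq_bigr => k _.
by rewrite orth_proj_form.
Qed.

End projection.

(** * The range of a contractive idempotent *)

Section fixed_space.
Context (R : realType) (H : completeNormedModType R) (P : {linear H -> H}).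

Definition fixed_pred : pred H := fun x => P x == x.

Lemma fixed_pred_submod : subsemimod_closed fixed_pred.
Proof.
rewrite /fixed_pred; split; first split; rewrite ?unfold_in ?linear0//.
- by move=> x y; rewrite !unfold_in => /eqP xP /eqP yP; rewrite linearD xP yP.
- by move=> a x; rewrite !unfold_in => /eqP xP; rewrite linearZ/= xP.
Qed.

(** The contraction hypothesis is an argument of the type, so that the
    completeness instance, whose proof needs it, can be attached to this type.
    *)
Definition fixed_space of (forall x, `|P x| <= `|x|) : Type :=
  {x : H | fixed_pred x}.

Hypothesis P_norm : forall x, `|P x| <= `|x|.
Notation E := (fixed_space P_norm).
HB.instance Definition _ := SubChoice.on E.
HB.instance Definition _ :=
  GRing.SubChoice_isSubLmodule.Build R H fixed_pred E fixed_pred_submod.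

Let nrm (x : E) : R := `|val x|.
Let nrmD x y : nrm (x + y) <= nrm x + nrm y.
Proof. by rewrite /nrm raddfD ler_normD. Qed.
Let nrmZ (l : R) x : nrm (l *: x) = `|l| * nrm x.
Proof. by rewrite /nrm linearZ normrZ. Qed.
Let nrm0 x : nrm x = 0 -> x = 0.
Proof. by move=> /normr0_eq0 x0; apply: val_inj; rewrite x0 raddf0. Qed.
HB.instance Definition _ := @Lmodule_isNormed.Build R E nrm nrmD nrmZ nrm0.

Lemma fixed_normE (x : E) : `|x| = `|val x|. Proof. by []. Qed.

Lemma fixed_valB (x y : E) : val (x - y) = val x - val y.
Proof. by rewrite raddfB. Qed.

(** A limit in H of a Cauchy filter on the fixed points is a fixed point,
    because P is continuous. *)
Lemma fixed_complete (F : set_system E) :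
  ProperFilter F -> cauchy F -> cvg F.
Proof.
move=> FF /cauchy_ballP FC.
have : cauchy (val @ F).
  apply/cauchy_ballP => e e0; have := FC _ e0.
  rewrite !near_simpl => -[[A B] /= [FA FB] AB].
  exists (val @` A, val @` B) => /=.
    by split; [apply: filterS FA|apply: filterS FB] => x ?; exists x.
  move=> [_ _] /= [[a Aa <-] [b Bb <-]].
  by have := AB (a, b) (conj Aa Bb); rewrite -!ball_normE/= fixed_normE fixed_valB.
move=> /cauchy_cvg /cvg_ex[/= l Fl].
have Pl : fixed_pred l.
  rewrite /fixed_pred -subr_eq0 -normr_le0; apply/ler_addgt0Pr => e e0.
  have e2 : 0 < e / 2 by rewrite divr_gt0.
  have /cvgrPdist_lt/(_ _ e2)/filter_ex[x lx] := Fl.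
  have /eqP Px := valP x.
  have -> : P l - l = P (l - val x) - (l - val x).
    by rewrite raddfB/= Px opprB addrA subrK.
  rewrite add0r (le_trans (ler_normB _ _))// (splitr e) lerD//.
    exact: le_trans (P_norm _) (ltW lx).
  exact: ltW.
apply/cvg_ex; exists (exist _ l Pl : E).
apply/cvgrPdist_lt => e e0.
near=> x; rewrite fixed_normE fixed_valB /=.
near: x.
by move/cvgrPdist_lt: Fl; apply.
Unshelve. all: by end_near. Qed.

HB.instance Definition _ := Uniform_isComplete.Build E fixed_complete.
End fixed_space.

(** * Factorization of Hilbert-Schmidt operators *)

(** Turns finiteness of an extended-real sum over an arbitrary set into a
    bound on real sums over duplicate-free sequences. *)
Lemma esum_seq_bound (R : realType) (T : choiceType) (A : set T) (f : T -> R) :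
  (forall x, 0 <= f x) -> (\esum_(x in A) (f x)%:E < +oo)%E ->
  exists C : R, forall s : seq T, uniq s -> {in s, forall x, A x} ->
    \sum_(x <- s) f x <= C.
Proof.
move=> f0 foo.
have fin : (\esum_(x in A) (f x)%:E)%E \is a fin_num.
  by rewrite ge0_fin_numE// esum_ge0// => x _; rewrite lee_fin.
exists (fine (\esum_(x in A) (f x)%:E)) => s us sA.
rewrite -lee_fin fineK//; apply: esum_ge; exists [set` s].
  by split; [exact: finite_seq|exact: sA].
by rewrite -sumEFin fsbig_seq.
Qed.

(** Only finitely many x have f x >= 1 / (n + 1): more than C * (n + 1) of
    them would have a sum exceeding C. *)
Lemma countable_support (R : realType) (T : choiceType) (A : set T)
    (f : T -> R) (C : R) : (forall x, 0 <= f x) ->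
  (forall s : seq T, uniq s -> {in s, forall x, A x} ->
    \sum_(x <- s) f x <= C) ->
  countable (A `&` [set x | 0 < f x]).
Proof.
move=> f0 fC.
have -> : A `&` [set x | 0 < f x] =
    \bigcup_n (A `&` [set x | n.+1%:R^-1 <= f x]).
  apply/seteqP; split=> [x [Ax fx]|x [n _ [Ax fx]]]; last first.
    by split=> //; apply: lt_le_trans fx; rewrite invr_gt0.
  have [n nf] := ltr_add_invr (y := 0) (x := f x) fx.
  by exists n => //; split=> //=; rewrite add0r in nf; exact: ltW.
apply: bigcup_countable => // n _; apply: finite_set_countable.
apply: contrapT => inf.
have [k Ck] : exists k : nat, C * n.+1%:R < k%:R.
  by exists (Num.truncn (C * n.+1%:R)).+1; exact: truncnS_gt.
have [B BA kB] := infinite_set_fset k inf.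
have := fC (finmap.enum_fset B) (finmap.fset_uniq B) (fun x xB => (BA x xB).1).
apply/negP; rewrite -ltNge.
apply: (@lt_le_trans _ _ (k%:R * n.+1%:R^-1)); first by rewrite ltr_pdivlMr.
apply: (@le_trans _ _ (\sum_(x <- finmap.enum_fset B) n.+1%:R^-1)); last first.
  by rewrite !big_seq; apply: ler_sum => x /BA[].
rewrite big_const_seq count_predT iter_addr_0 -[X in _ <= X]mulr_natl.
by rewrite ler_wpM2r// ler_nat.
Qed.

Section hs_basis.
Context (R : realType) (H K : completeNormedModType R).
Context (S0 : {linear_continuous H -> K}).

(** An orthonormal basis may be uncountable, but only countably many of its
    vectors have a nonzero image. Those are listed as a sequence, with zeros
    at the unused indices; S0 vanishes on their orthogonal complement, since x
    - P x is in the kernel of S0 for each basis vector x, hence for each x by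
    density. *)
Lemma hilbert_schmidt_basis_sequence : hilbert_schmidt S0 ->
  exists (Q : {symmetric H}) (e : nat -> H) (C : R),
  [/\ inner_product Q,
      (forall i j, i != j -> Q (e i) (e j) = 0),
      (forall i, e i = 0 \/ `|e i| = 1),
      (forall n, \sum_(0 <= k < n) `|S0 (e k)| ^+ 2 <= C) &
      forall h, (forall k, Q h (e k) = 0) -> S0 h = 0].
Proof.
move=> [A [Q [QE QA Adense]] Aoo].
have [C SC] := esum_seq_bound (fun x => sqr_ge0 _) Aoo.
have cA := countable_support (fun x => sqr_ge0 _) SC.
set A' := (X in countable X) in cA.
(* f numbers the basis vectors with nonzero image; e inverts it. *)
have [f finj] := countable_injP _ cA.
have eP k : exists x : H, (A' x /\ f x = k) \/
    (x = 0 /\ ~ exists2 y, A' y & f y = k).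
  have [[x Ax fx]|nx] := pselect (exists2 y, A' y & f y = k).
    by exists x; left.
  by exists 0; right.
have [e eE] := choice eP.
have eA k : e k = 0 \/ (A' (e k) /\ f (e k) = k).
  by case: (eE k) => [[? ?]|[? ?]]; [right|left].
have Ae x : A' x -> x = e (f x).
  move=> Ax; case: (eE (f x)) => [[Aex fx]|[_ []]]; last by exists x.
  by apply: finj => //; exact/mem_set.
have e_orth i j : i != j -> Q (e i) (e j) = 0.
  move=> ij; have [->|[[Ai _] fi]] := eA i; first by rewrite linear0l.
  have [->|[[Aj _] fj]] := eA j; first by rewrite linear0r.
  rewrite QA// (_ : _ == _ = false)//; apply: contra_neqF ij => /eqP eij.
  by rewrite -fi -fj eij.
have e_unit i : e i = 0 \/ `|e i| = 1.
  have [->|[[Ai _] fi]] := eA i; [by left|right].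
  have := QE (e i); rewrite QA// eqxx => /esym/eqP.
  by rewrite sqrf_eq1 => /orP[/eqP//|/eqP]; have := normr_ge0 (e i); lra.
exists Q, e, C; split => //.
- move=> n; pose s := [seq e k | k <- [seq k <- iota 0 n | e k != 0]].
  have us : uniq s.
    rewrite map_inj_in_uniq ?filter_uniq ?iota_uniq// => i j.
    rewrite !mem_filter => /andP[ei _] /andP[ej _] eij.
    have [e0|[_ fi]] := eA i; first by rewrite e0 eqxx in ei.
    have [e0|[_ fj]] := eA j; first by rewrite e0 eqxx in ej.
    by rewrite -fi -fj eij.
  have sA : {in s, forall x, A x}.
    move=> _ /mapP[i + ->]; rewrite mem_filter => /andP[ei _].
    by have [e0|[[]]] := eA i; first by rewrite e0 eqxx in ei.
  (* The zeros that pad e contribute nothing. *)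
  apply: le_trans (SC s us sA); rewrite big_map big_filter.
  rewrite [X in _ <= X]big_mkcond /index_iota subn0.
  apply: ler_sum => k _; case: eqVneq => [->|//].
  by rewrite linear0 normr0 expr0n.
- have P_norm := orth_proj_norm QE e_orth e_unit.
  have [P PE] : exists P : {linear H -> H}, P =1 orth_proj Q e.
    by exists (HB.pack_for {linear H -> H} (orth_proj Q e)
      (GRing.isLinear.Build _ _ _ _ _ (orth_proj_linear QE e_orth e_unit))).
  have PA x : A x -> S0 (x - P x) = 0.
    move=> Ax; have [S0x|S0x] := eqVneq (S0 x) 0.
      suff -> : P x = 0 by rewrite subr0.
      rewrite PE; apply: cvg_lim => //; under eq_fun.
        move=> n; rewrite big1 => [|k _]; first over.
        have [->|[[Ak +] _]] := eA k; first by rewrite scaler0.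
        rewrite QA//=; case: eqVneq => [<-|]; last by rewrite scale0r.
        by rewrite S0x normr0 expr0n ltxx.
      exact: cvg_cst.
    have A'x : A' x by split => //=; rewrite exprn_gt0// normr_gt0.
    suff -> : P x = x by rewrite subrr linear0.
    by rewrite PE (Ae _ A'x) orth_proj_basis.
  have Pspan z : linear_span A z -> S0 (z - P z) = 0.
    move=> [n [a [x [Ax ->]]]]; rewrite linear_sum -sumrB linear_sum big1// => i _.
    by rewrite linearZ/= -scalerBr linearZ/= PA ?scaler0.
  move=> h he; have Ph : P h = 0.
    rewrite PE; apply: cvg_lim => //; under eq_fun.
      by move=> n; rewrite big1 => [|k _]; [over|rewrite he scale0r].
    exact: cvg_cst.
  apply/normr0_eq0/eqP; rewrite eq_le normr_ge0 andbT.
  apply/ler_addgt0Pr => r r0; rewrite add0r.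
  have /cvgrPdist_lt/(_ _ r0) := @cts_fun _ _ S0 0.
  move=> /nbhs_ballP[d /= d0]; rewrite linear0 => dS.
  have d2 : 0 < d / 2 by rewrite divr_gt0.
  have [z zA hz] := dense_normP Adense h d2.
  have -> : S0 h = S0 ((h - z) - P (h - z)).
    have -> : (h - z) - P (h - z) = h - (z - P z).
      by rewrite linearB Ph sub0r opprK opprB addrA addrAC.
    by rewrite linearB/= (Pspan _ zA) subr0.
  have hzd : `|0 - ((h - z) - P (h - z))| < d.
    rewrite sub0r normrN (le_lt_trans (ler_normB _ _))// (splitr d).
    by rewrite ltrD// PE (le_lt_trans (P_norm _)).
  have /dS : ball 0 d (h - z - P (h - z)) by rewrite -ball_normE.
  rewrite /= sub0r normrN; exact: ltW.
Qed.
End hs_basis.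

(** Seminorms obtained by pulling back a Hilbert norm are Hilbertian. *)
Lemma restrict_form (R : realType) (V W : lmodType R) (Q : {symmetric W})
    (f : {linear V -> W}) :
  exists Q' : {symmetric V}, forall x y, Q' x y = Q (f x) (f y).
Proof.
pose q x y := Q (f x) (f y).
have qb : bilinear_for *%R *%R q.
  split=> [y a u v|x a u v]; rewrite /q !linearP.
    by rewrite linearDl/= formZl.
  by [].
have qs x y : q x y = (-1) ^+ false * idfun (q y x).
  by rewrite expr0 mul1r /q formC.
by exists (HB.pack_for {symmetric V} q
  (bilinear_isBilinear.Build R V V R *%R *%R q qb)
  (isHermitianSesquilinear.Build R V false idfun q qs)).
Qed.

(** Hides the construction of the fixed space behind its inclusion inc and its
    projection pi. *)
Lemma split_contractive_idempotent (R : realType) (H : completeNormedModType R)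
    (P : {linear H -> H}) : (forall x, `|P x| <= `|x|) ->
  (forall x, P (P x) = P x) ->
  exists (E : completeNormedModType R) (inc : {linear E -> H})
    (pi : {linear H -> E}),
  [/\ forall v, `|inc v| = `|v|, forall v, pi (inc v) = v &
      forall h, inc (pi h) = P h].
Proof.
move=> P_norm PK; pose E : completeNormedModType R := fixed_space P_norm.
have Pfix h : fixed_pred P (P h) by rewrite /fixed_pred PK.
pose p h : E := exist _ (P h) (Pfix h).
have plin : linear p by move=> a u v; apply: val_inj; rewrite /= linearP.
pose pi := HB.pack_for {linear H -> E} p (GRing.isLinear.Build _ _ _ _ p plin).
exists E, (val : {linear E -> H}), pi; split => // v.
by apply: val_inj; exact/eqP/(valP v).
Qed.

(** E is the closed span of the basis vectors that S0 does not kill, pi the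
    orthogonal projection on it and x the images of these vectors. E is
    separable even if H is not, which makes the topology of the seminorm of pi
    countably Hilbertian; and S0 h depends only on pi h. *)
Lemma hilbert_schmidt_factorization (R : realType) (H K : completeNormedModType R)
    (S0 : {linear_continuous H -> K}) : hilbert_schmidt S0 ->
  exists (E : completeNormedModType R) (Q : {symmetric E}) (e : nat -> E)
    (pi : {linear H -> E}) (x : nat -> K) (C : R),
  [/\ inner_product Q,
      (forall i j, i != j -> Q (e i) (e j) = 0) /\
        (forall i, e i = 0 \/ `|e i| = 1),
      (forall h, `|pi h| <= `|h|) /\ (forall v, exists h, pi h = v),
      (forall v, (fun n => \sum_(0 <= k < n) Q v (e k) *: e k) @ \oo --> v) &
      (forall h, (fun n => \sum_(0 <= k < n) Q (pi h) (e k) *: x k) @ \oo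
        --> S0 h) /\
      (forall n, \sum_(0 <= k < n) `|x k| ^+ 2 <= C)].
Proof.
move=> /hilbert_schmidt_basis_sequence[Q [e [C [QE e_orth e_unit SC S0ker]]]].
have [P PE] : exists P : {linear H -> H}, P =1 orth_proj Q e.
  by exists (HB.pack_for {linear H -> H} (orth_proj Q e)
    (GRing.isLinear.Build _ _ _ _ _ (orth_proj_linear QE e_orth e_unit))).
have P_norm x : `|P x| <= `|x| by rewrite PE; exact: orth_proj_norm.
have PK x : P (P x) = P x by rewrite !PE orth_projK.
have [E [inc [pi [incN incK piE]]]] := split_contractive_idempotent P_norm PK.
have [Q' Q'E] := restrict_form Q inc.
have valpi h : inc (pi h) = orth_proj Q e h by rewrite piE PE.
have vale k : inc (pi (e k)) = e k by rewrite valpi orth_proj_basis.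
have Q'e v k : Q' v (pi (e k)) = Q (inc v) (e k) by rewrite Q'E vale.
exists E, Q', (pi \o e), pi, (S0 \o e), C; split.
- by move=> v; rewrite Q'E QE incN.
- split=> [i j ij|i]; first by rewrite Q'E !vale e_orth.
  have [ei|ei] := e_unit i; [left|right]; last by rewrite -incN vale.
  by apply/normr0_eq0; rewrite -incN vale ei normr0.
- split=> [h|v]; last by exists (inc v).
  by rewrite -incN valpi; exact: orth_proj_norm.
- move=> v; apply/cvgrPdist_lt => r r0.
  have Pv : orth_proj Q e (inc v) = inc v by rewrite -valpi incK.
  have := orth_proj_cvg QE e_orth e_unit (x := inc v); rewrite Pv.
  move/cvgrPdist_lt => /(_ _ r0); apply: filterS => n.
  have -> : \sum_(0 <= k < n) Q (inc v) (e k) *: e k =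
      inc (\sum_(0 <= k < n) Q' v ((pi \o e) k) *: (pi \o e) k).
    by rewrite linear_sum; apply: eq_bigr => k _; rewrite linearZ/= vale Q'e.
  by rewrite -linearB incN.
- split=> // h; have -> : S0 h = S0 (orth_proj Q e h).
    apply/subr0_eq; rewrite -linearB/=; apply: S0ker => k.
    by rewrite linearBl/= orth_proj_form// subrr.
  have := cvg_comp _ _ (orth_proj_cvg QE e_orth e_unit (x := h))
    (@cts_fun _ _ S0 (orth_proj Q e h)).
  apply: cvg_trans; apply: near_eq_cvg; apply: nearW => n /=.
  rewrite linear_sum; apply: eq_bigr => k _.
  by rewrite linearZ/= Q'e valpi orth_proj_form.
Qed.


(** * Probabilities as real numbers *)

Section mset.
Context (R : realType) d (Omega : measurableType d).
Implicit Types f g : Omega -> R.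
Lemma measurable_set_bool (b : Omega -> bool) : measurable_fun setT b ->
  measurable [set w | b w].
Proof.
by move=> mb; have := mb measurableT [set true] I; rewrite setTI.
Qed.
Lemma measurable_set_le f g : measurable_fun setT f -> measurable_fun setT g ->
  measurable [set w | f w <= g w].
Proof. by move=> mf mg; apply: measurable_set_bool; exact: measurable_fun_ler. Qed.
Lemma measurable_set_lt f g : measurable_fun setT f -> measurable_fun setT g ->
  measurable [set w | f w < g w].
Proof. by move=> mf mg; apply: measurable_set_bool; exact: measurable_fun_ltr. Qed.
End mset.

Section probability_real.
Context (R : realType) d (Omega : measurableType d) (P : probability Omega R).
Implicit Types A B : set Omega.

(** Probabilities as reals, so that linear arithmetic applies to the many
    estimates below. *)
Definition pr A : R := fine (P A).

Lemma prE A : measurable A -> P A = (pr A)%:E.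
Proof. by move=> mA; rewrite /pr fineK// fin_num_measure. Qed.

Lemma pr_le1 A : measurable A -> pr A <= 1.
Proof. by move=> mA; rewrite -lee_fin -prE// probability_le1. Qed.

Lemma pr_mono_ae A B : measurable A -> measurable B ->
  {ae P, forall w, A w -> B w} -> pr A <= pr B.
Proof.
move=> mA mB [N [mN N0 sub]]; rewrite -lee_fin -!prE//.
have AB : A `<=` B `|` N.
  by move=> w Aw; have [|nB] := pselect (B w); [left|right; apply: sub => /(_ Aw)].
apply: (le_trans (le_measure P _ _ AB)); rewrite ?inE//; first exact: measurableU.
by apply: (le_trans (measureU2 _ mB mN)); rewrite [X in (_ + X)%E]N0 adde0.
Qed.

Lemma pr_mono A B : measurable A -> measurable B -> A `<=` B -> pr A <= pr B.
Proof. by move=> mA mB AB; apply: pr_mono_ae => //; apply: aeW => w; exact: AB. Qed.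

Lemma prU A B : measurable A -> measurable B -> pr (A `|` B) <= pr A + pr B.
Proof.
move=> mA mB; rewrite -lee_fin EFinD -!prE//; last exact: measurableU.
exact: measureU2.
Qed.

Lemma pr_bigcup_le (F : nat -> set Omega) (e : R) :
  (forall n, measurable (F n)) -> {homo F : n m / (n <= m)%N >-> n `<=` m} ->
  (forall n, pr (F n) <= e) -> pr (\bigcup_n F n) <= e.
Proof.
move=> mF homF Fe; have mU := bigcupT_measurable _ mF.
rewrite -lee_fin -prE//.
have cvF : (P \o F) n @[n --> \oo] --> P (\bigcup_n F n).
  apply: nondecreasing_cvg_mu => // n m nm.
  by apply/subsetPset; exact: homF.
rewrite -(cvg_lim _ cvF)//; apply: lime_le.
  by apply/cvg_ex; eexists; exact: cvF.
by apply: nearW => n /=; rewrite prE// lee_fin.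
Qed.

Lemma bounded_integrable (f : Omega -> R) (M : R) :
  measurable_fun setT f -> (forall w, `|f w| <= M) ->
  P.-integrable setT (EFin \o f).
Proof.
move=> mf fM; apply: measurable_bounded_integrable => //.
  by apply: le_lt_trans (probability_le1 P measurableT) _; rewrite ltry.
exists M; split; first exact: num_real.
by move=> x Mx w _ /=; rewrite (le_trans (fM w))// ltW.
Qed.

Lemma Rintegral_seq_sum (I : Type) (s : seq I) (f : I -> Omega -> R) :
  (forall i, P.-integrable setT (EFin \o f i)) ->
  P.-integrable setT (EFin \o (fun w => \sum_(i <- s) f i w)) /\
  \int[P]_w (\sum_(i <- s) f i w) = \sum_(i <- s) \int[P]_w f i w.
Proof.
move=> fi; elim: s => [|i s [IHi IHe]].
  under eq_fun do rewrite big_nil; rewrite big_nil; split.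
    exact: integrable0.
  by rewrite /Rintegral integral0.
under eq_fun do rewrite big_cons; rewrite big_cons; split.
  by have := integrableD measurableT (fi i) IHi.
by rewrite RintegralD// IHe.
Qed.

(** A form of Markov's inequality. *)
Lemma pr_le_Rintegral A (c : R) (f : Omega -> R) : measurable A -> 0 <= c ->
  P.-integrable setT (EFin \o f) -> (forall w, c * \1_A w <= f w) ->
  c * pr A <= \int[P]_w f w.
Proof.
move=> mA c0 fi cf.
have -> : c * pr A = \int[P]_w (c * \1_A w).
  rewrite RintegralZl//; last exact: integrable_indic.
  by rewrite /Rintegral integral_indic// setIT.
apply: le_Rintegral => //.
by have := integrableZl measurableT c (integrable_indic P mA).
Qed.

(** Double counting: if almost every point of A lies in at least c of the sets
    B i, then c times the probability of A is at most the sum of those of the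
    B i. *)
Lemma pr_average (I : Type) (s : seq I) A (B : I -> set Omega) (c : R) :
  measurable A -> (forall i, measurable (B i)) -> 0 <= c ->
  {ae P, forall w, A w -> c <= \sum_(i <- s) \1_(B i) w} ->
  c * pr A <= \sum_(i <- s) pr (B i).
Proof.
move=> mA mB c0 [N [mN N0 sub]].
have mAN : measurable (A `\` N) by exact: measurableD.
have AB w : (A `\` N) w -> c <= \sum_(i <- s) \1_(B i) w.
  by move=> [Aw Nw]; apply: contrapT => h; apply: Nw; apply: sub => /(_ Aw).
have {sub} : pr A <= pr (A `\` N).
  apply: pr_mono_ae => //; exists N; split => // w /=.
  by apply: contra_notP => Nw Aw.
move=> /(ler_wpM2l c0)/le_trans; apply.
have Bi i : P.-integrable setT (EFin \o \1_(B i)) by exact: integrable_indic.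
have [si sE] := Rintegral_seq_sum s Bi.
have -> : \sum_(i <- s) pr (B i) = \int[P]_w \sum_(i <- s) \1_(B i) w.
  by rewrite sE; apply: eq_bigr => i _; rewrite /Rintegral integral_indic// setIT.
apply: pr_le_Rintegral => // w; rewrite indicE.
case: (boolP (w \in A `\` N)) => [|_]; first by rewrite inE mulr1 => /AB.
by rewrite mulr0; apply: sumr_ge0 => i _; rewrite indicE.
Qed.

End probability_real.

(** * Tails from Fourier transforms *)

Section fourier_tail.
Context (R : realType).

(** The slope of a chord of sin on [0, 1] is a value of cos there, and cos
    decreases. *)
Lemma sin_ge_linear (u : R) : 0 <= u <= 1 -> cos 1 * u <= sin u.
Proof.
move=> /andP[]; rewrite le_eqVlt => /predU1P[<- _|u0 u1].
  by rewrite mulr0 sin0.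
have sin_cts : {within `[0, u], continuous (@sin R)}.
  exact/continuous_subspaceT/continuous_sin.
have [c /andP[c0 cu]] := MVT u0 (fun x _ => is_derive_sin x) sin_cts.
rewrite sin0 !subr0 => ->; rewrite ler_pM2r//.
rewrite !bnd_simp in c0 cu ; have := pi_ge2 R => pi2.
apply/ltW; rewrite ltr_cos ?in_itv/=; lra.
Qed.

(** The closed form of the Dirichlet kernel; the sum telescopes since 2 sin (t
    / 2) cos (j t) = sin ((j + 1/2) t) - sin ((j - 1/2) t). *)
Lemma dirichlet_telescope (t : R) N :
  2 * sin (t / 2) * \sum_(1 <= j < N.+1) cos (j%:R * t) =
  sin ((N%:R + 2^-1) * t) - sin (t / 2).
Proof.
elim: N => [|N IH]; first by rewrite big_geq// mulr0 add0r mulrC subrr.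
rewrite big_nat_recr//= mulrDr IH.
rewrite (_ : (N.+1%:R + 2^-1) * t = N.+1%:R * t + t / 2); last by ring.
rewrite (_ : (N%:R + 2^-1) * t = N.+1%:R * t - t / 2); last first.
  by rewrite -addn1 natrD; field.
by rewrite sinB (sinD (_ * t) (t / 2)); ring.
Qed.

(** A discrete substitute for 1 - sin y / y >= 1/2: the grid is fine enough
    for the Dirichlet sum at angle y / N to be at most half of N as soon as y
    is larger than a universal constant. No integral over the frequency, hence
    no Fubini theorem, is needed for the tail estimate. *)
Lemma cos_average_ge (y : R) N : 4 / cos 1 <= `|y| -> `|y| <= N%:R ->
  N%:R / 2 <= \sum_(1 <= j < N.+1) (1 - cos (j%:R / N%:R * y)).
Proof.
move=> cy yN; have c0 := cos1_gt0 R.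
have y0 : 0 < `|y| by apply: lt_le_trans cy; rewrite divr_gt0.
have N0 : 0 < N%:R :> R := lt_le_trans y0 yN.
pose t := `|y| / N%:R.
have t0 : 0 < t by rewrite divr_gt0.
have t1 : t <= 1 by rewrite ler_pdivrMr// mul1r.
rewrite sumrB big_const_nat subn1 iter_addr_0/=.
under eq_bigr => j _.
  rewrite (_ : _ * y = j%:R * (y / N%:R)); last by ring.
  rewrite -cos_norm normrM [`|j%:R|]ger0_norm// normrM normfV.
  rewrite [`|N%:R|]ger0_norm ?ltW// -/t; over.
set S := \sum_(_ <= _ < _) _.
have sin_t : cos 1 * (t / 2) <= sin (t / 2) by apply: sin_ge_linear; lra.
have s0 : 0 < sin (t / 2) by apply: lt_le_trans sin_t; rewrite !mulr_gt0 ?invr_gt0.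
have : 2 * sin (t / 2) * S <= 2.
  rewrite dirichlet_telescope; have := sin_le1 ((N%:R + 2^-1) * t); lra.
have : sin (t / 2) * N%:R >= 2.
  apply: (@le_trans _ _ (cos 1 * (t / 2) * N%:R)); last by rewrite ler_pM2r.
  rewrite /t (_ : _ * N%:R = cos 1 * `|y| / 2); last by field; rewrite gt_eqF.
  by move: cy; rewrite ler_pdivrMr//; lra.
move=> sN sS.
have : sin (t / 2) * S <= sin (t / 2) * (N%:R / 2) by lra.
by rewrite ler_pM2l//; lra.
Qed.

Context d (Omega : measurableType d) (P : probability Omega R).

(** Integrate the preceding inequality at y = Z w. It controls Z between the
    constant and N, uniformly in N, and N goes to infinity. *)
Lemma fourier_tail_bound (Z : Omega -> R) (e : R) : measurable_fun setT Z ->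
  (forall s, 0 <= s <= 1 -> 1 - e <= \int[P]_w cos (s * Z w)) ->
  pr P [set w | 4 / cos 1 <= `|Z w|] <= 2 * e.
Proof.
move=> mZ Ze; pose A N := [set w | 4 / cos 1 <= `|Z w| <= N%:R].
have mnZ : measurable_fun setT (fun w => `|Z w|) by exact: measurableT_comp.
have mA N : measurable (A N).
  rewrite (_ : A N = [set w | 4 / cos 1 <= `|Z w|] `&` [set w | `|Z w| <= N%:R]).
    by apply: measurableI; apply: measurable_set_le.
  by apply/seteqP; split=> w; rewrite /A /= => /andP.
have mcos s : measurable_fun setT (fun w => cos (s * Z w)).
  apply: (measurableT_comp (f := @cos R)); last exact: measurable_funM.
  by apply: continuous_measurable_fun; exact: continuous_cos.
have -> : [set w | 4 / cos 1 <= `|Z w|] = \bigcup_N A N.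
  apply/seteqP; split => [w /= h|w [N _] /= /andP[]//].
  exists (Num.truncn `|Z w|).+1 => //; rewrite /A/= h/= ltW//.
  exact: truncnS_gt.
apply: pr_bigcup_le => // [n m nm w|N].
  by rewrite /A/= => /andP[-> /= Zn]; rewrite (le_trans Zn)// ler_nat.
case: N => [|N].
  have -> : A 0%N = set0.
    rewrite -subset0 => w; rewrite /A/= => /andP[h1 h2].
    have := cos1_gt0 R => c0; have : 0 < 4 / cos 1 :> R by rewrite divr_gt0.
    lra.
  rewrite /pr measure0 mulr_ge0//.
  have := Ze 0; rewrite lexx ler01 => /(_ isT).
  under eq_Rintegral do rewrite mul0r cos0.
  rewrite Rintegral_cst//= probability_setT/= ; lra.
pose f j w := 1 - cos (j%:R / N.+1%:R * Z w).
have mf j : measurable_fun setT (f j) by exact: measurable_funB.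
have fi j : P.-integrable setT (EFin \o f j).
  apply: (@bounded_integrable _ _ _ _ _ 2) => // w; rewrite /f ler_norml.
  have := cos_le1 (j%:R / N.+1%:R * Z w); have := cos_geN1 (j%:R / N.+1%:R * Z w).
  lra.
have [Si SE] := Rintegral_seq_sum (index_iota 1 N.+2) fi.
have : N.+1%:R / 2 * pr P (A N.+1) <= N.+1%:R * e.
  apply: (@le_trans _ _ (\int[P]_w \sum_(1 <= j < N.+2) f j w)).
    apply: pr_le_Rintegral => // w; rewrite indicE.
    case: (boolP (w \in A N.+1)) => [|_].
      by rewrite inE mulr1 /A/= => /andP[]; exact: cos_average_ge.
    rewrite mulr0; apply: sumr_ge0 => j _; rewrite /f.
    by rewrite subr_ge0 cos_le1.
  rewrite SE (@le_trans _ _ (\sum_(1 <= j < N.+2) e))//; last first.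
    by rewrite big_const_nat iter_addr_0 subn1 /= [X in _ <= X]mulr_natl.
  rewrite !big_nat; apply: ler_sum => j /andP[j1 jN].
  rewrite /f RintegralB//.
  - rewrite Rintegral_cst//= probability_setT/= mulr1 lerBlDl -lerBlDr.
    by apply: Ze; rewrite divr_ge0//= ler_pdivrMr// mul1r ler_nat.
  - exact: (@bounded_integrable _ _ _ _ _ `|1|).
  - apply: (@bounded_integrable _ _ _ _ _ 1) => // w.
    by rewrite cos_max.
by rewrite -mulrA ler_pM2l//; lra.
Qed.

End fourier_tail.

(** * Equicontinuity of suprema over countably many times *)

Section equicontinuity.
Context (R : realType) d (Omega : measurableType d) (P : probability Omega R).
Context (K : completeNormedModType R) (U : nat -> K -> Omega -> R).
Hypothesis mU : forall i x, measurable_fun setT (U i x).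
Hypothesis U_linear : forall i a x y,
  {ae P, forall w, U i (a *: x + y) w = a * U i x w + U i y w}.
Hypothesis U_cts : forall i (c e : R), 0 < c -> 0 < e -> exists2 r : R, 0 < r &
  forall x, `|x| < r -> pr P [set w | c <= `|U i x w|] <= e.
Hypothesis U_bounded : forall x,
  {ae P, forall w, exists M, forall i, `|U i x w| <= M}.

(** The finite version of exceed_some: a maximum over finitely many indices
    varies continuously in probability, which a supremum need not do a priori.
    *)
Definition exceed m (c : R) x : set Omega :=
  [set w | exists2 i, (i < m)%N & c < `|U i x w|].

Definition exceed_some (c : R) x : set Omega :=
  [set w | exists i, c < `|U i x w|].

Let mlt c i x : measurable [set w | c < `|U i x w|].
Proof. by apply: measurable_set_lt => //; exact: measurableT_comp. Qed.

Let mle c i x : measurable [set w | c <= `|U i x w|].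
Proof. by apply: measurable_set_le => //; exact: measurableT_comp. Qed.

Lemma measurable_exceed m c x : measurable (exceed m c x).
Proof.
rewrite (_ : exceed m c x = \bigcup_(i in `I_m) [set w | c < `|U i x w|]).
  exact: bigcup_measurable.
by apply/seteqP; split => w [i im cw]; exists i.
Qed.

Lemma exceed_someE c x : exceed_some c x = \bigcup_m exceed m c x.
Proof.
apply/seteqP; split => [w [i cw]|w [m _ [i im cw]]]; last by exists i.
by exists i.+1 => //; exists i.
Qed.

Lemma measurable_exceed_some c x : measurable (exceed_some c x).
Proof.
rewrite exceed_someE; apply: bigcupT_measurable => m; exact: measurable_exceed.
Qed.

Lemma exceed_le m n c x : (m <= n)%N -> exceed m c x `<=` exceed n c x.
Proof. by move=> mn w [i im cw]; exists i => //; exact: leq_trans mn. Qed.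

Lemma pr_exceed_some c x (e : R) : (forall m, pr P (exceed m c x) <= e) ->
  pr P (exceed_some c x) <= e.
Proof.
move=> h; rewrite exceed_someE; apply: pr_bigcup_le => // [m|m n mn].
  exact: measurable_exceed.
exact: exceed_le.
Qed.

Let ae_sub i x y : {ae P, forall w, U i (x - y) w = U i x w - U i y w}.
Proof.
apply: filterS (U_linear i (-1) y x) => w.
by rewrite scaleN1r addrC => ->; rewrite mulN1r addrC.
Qed.

(** If neither y nor z exceeds its level at time i, then x does not exceed the
    sum of the levels. *)
Lemma exceed_triangle m (a b c : R) x y z : a + b <= c ->
  (forall i, {ae P, forall w, `|U i x w| <= `|U i y w| + `|U i z w|}) ->
  pr P (exceed m c x) <= pr P (exceed m a y) + pr P (exceed m b z).
Proof.
move=> cab /ae_foralln xyz.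
have my := measurable_exceed m a y; have mz := measurable_exceed m b z.
apply: le_trans (prU P my mz); apply: pr_mono_ae.
- exact: measurable_exceed.
- exact: measurableU.
apply: filterS xyz => w xyz [i im cw].
have [ay|ay] := ltP a `|U i y w|; first by left; exists i.
by right; exists i => //; have := xyz i; lra.
Qed.

Lemma exceed_small m (c e : R) : 0 < c -> 0 < e -> exists2 r : R, 0 < r &
  forall x, `|x| < r -> pr P (exceed m c x) <= e.
Proof.
move=> c0; elim: m e => [|m IH] e e0.
  exists 1 => // x _; rewrite (_ : exceed 0 c x = set0) ?/pr ?measure0 ?ltW//.
  by rewrite -subset0 => w [].
have e2 : 0 < e / 2 by rewrite divr_gt0.
have [r r0 hr] := IH _ e2; have [s s0 hs] := U_cts m c0 e2.
exists (Num.min r s) => [|x]; first by rewrite lt_min r0.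
rewrite lt_min => /andP[xr xs]; rewrite [e]splitr.
apply: le_trans (lerD (hr _ xr) (hs _ xs)).
apply: le_trans (prU P (measurable_exceed m c x) (mle c m x)).
apply: pr_mono.
- exact: measurable_exceed.
- by apply: measurableU => //; exact: measurable_exceed.
move=> w [i im cw]; move: im; rewrite ltnS leq_eqVlt => /predU1P[im|im].
  by right; rewrite /= -im; exact: ltW.
by left; exists i.
Qed.

(** Strict inequality leaves room to raise the level c slightly, and where x
    exceeds c + d, either y exceeds c or x - y exceeds d; the latter is
    improbable for y near x. *)
Lemma exceed_open m (c e : R) x : e < pr P (exceed m c x) ->
  exists2 r : R, 0 < r & forall y, `|x - y| < r -> e < pr P (exceed m c y).
Proof.
move=> ex.
have [k ek] : exists k : nat, e < pr P (exceed m (c + k.+1%:R^-1) x).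
  apply: contrapT => /forallNP h; move: ex; apply/negP; rewrite -leNgt.
  rewrite (_ : exceed m c x = \bigcup_k exceed m (c + k.+1%:R^-1) x); last first.
    apply/seteqP; split=> [w [i im cw]|w [k _ [i im cw]]].
      by have [k ck] := ltr_add_invr cw; exists k => //; exists i.
    by exists i => //; apply: lt_trans cw; rewrite ltrDl invr_gt0 ltr0n.
  apply: pr_bigcup_le => [k|k l kl w [i im cw]|k].
  - exact: measurable_exceed.
  - exists i => //; apply: le_lt_trans cw; rewrite lerD2l lef_pV2 ?posrE//.
    by rewrite ler_nat.
  - by rewrite leNgt; exact/negP.
have k0 : 0 < k.+1%:R^-1 :> R by rewrite invr_gt0.
have h0 : 0 < (pr P (exceed m (c + k.+1%:R^-1) x) - e) / 2.
  by rewrite divr_gt0// subr_gt0.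
have [r r0 hr] := exceed_small m k0 h0.
exists r => // y xy; have := hr _ xy.
have : pr P (exceed m (c + k.+1%:R^-1) x) <=
    pr P (exceed m c y) + pr P (exceed m k.+1%:R^-1 (x - y)).
  apply: exceed_triangle => // i; apply: filterS (ae_sub i x y) => w ->.
  by rewrite -[X in `|X| <= _](subrK (U i y w)) addrC ler_normD.
lra.
Qed.

(** The almost sure bound of the sequence is an almost surely finite random
    variable, so its tails vanish. *)
Lemma exceed_some_vanishes x (e : R) : 0 < e ->
  exists n : nat, pr P (exceed_some n%:R x) <= e.
Proof.
move=> e0; apply: contrapT => /forallNP h.
have mE n := measurable_exceed_some n%:R x.
have mC n : measurable (~` exceed_some n%:R x) by exact: measurableC.
have : pr P (\bigcup_n ~` exceed_some n%:R x) <= 1 - e.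
  apply: pr_bigcup_le => // [n m nm w nE [i mi]|n].
    by apply: nE; exists i; apply: le_lt_trans mi; rewrite ler_nat.
  have : pr P (~` exceed_some n%:R x) = 1 - pr P (exceed_some n%:R x).
    by apply: EFin_inj; rewrite EFinB -!prE// probability_setC.
  by have /negP := h n; rewrite -ltNge; lra.
have : pr P setT <= pr P (\bigcup_n ~` exceed_some n%:R x).
  apply: pr_mono_ae => //; first exact: bigcupT_measurable.
  apply: filterS (U_bounded x) => w [M xM] _.
  exists (Num.truncn M).+1 => // -[i Mi]; move: Mi; apply/negP; rewrite -leNgt.
  by rewrite (le_trans (xM i))// ltW// truncnS_gt.
have -> : pr P setT = 1 by rewrite /pr probability_setT.
lra.
Qed.

(** The closed sets of the x whose supremum exceeds n with probability at most
    e / 2 cover K, since each supremum is almost surely finite. By Baire's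
    theorem one of them contains a ball; differences of points of the ball
    then fill a ball around 0, and linearity rescales the level n to an
    arbitrary c. *)
Lemma equicontinuity (c e : R) : 0 < c -> 0 < e -> exists2 r : R, 0 < r &
  forall x, `|x| < r -> pr P (exceed_some c x) <= e.
Proof.
move=> c0 e0; have e2 : 0 < e / 2 by rewrite divr_gt0.
(* The complement of O n is the set of the x whose supremum exceeds n with
   probability at most e / 2. *)
pose O n := [set x | exists m, e / 2 < pr P (exceed m n%:R x)].
have oO n : open (O n).
  rewrite openE => x [m mx]; apply/nbhs_ballP.
  have [r r0 hr] := exceed_open mx; exists r => // y.
  by rewrite -ball_normE/= => xy; exists m; exact: hr.
have [n nO] : exists n, ~ dense (O n).
  apply: contrapT => /forallNP h.
  have dO n : open (O n) /\ dense (O n) by split; [exact: oO|exact: contrapT (h n)].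
  have [x [_ Ox]] := Baire dO (ex_intro _ (0 : K) I) openT.
  have [n] := exceed_some_vanishes x e2; apply/negP; rewrite -ltNge.
  have [m mx] := Ox n I; apply: (lt_le_trans mx); apply: pr_mono.
  - exact: measurable_exceed.
  - exact: measurable_exceed_some.
  - by move=> w [i _ ci]; exists i.
have [V [[x0 [oV Vx0]] V0]] := denseNE nO.
have /nbhs_ballP[r /= r0 rV] : nbhs x0 V by exact: open_nbhs_nbhs.
have small x m : `|x| < r -> pr P (exceed m n%:R (x0 + x)) <= e / 2.
  move=> xr; rewrite leNgt; apply/negP => h.
  suff : (V `&` O n) (x0 + x) by rewrite V0.
  split; last by exists m.
  by apply: rV; rewrite -ball_normE/= opprD addrA subrr sub0r normrN.
(* x is the difference of x0 + x and x0. *)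
have small2 x : `|x| < r -> pr P (exceed_some (2 * n%:R) x) <= e.
  move=> xr; apply: pr_exceed_some => m; rewrite [e]splitr.
  have h0 : `|0 : K| < r by rewrite normr0.
  apply: le_trans (lerD (small x m xr) (small 0 m h0)); rewrite addr0.
  apply: exceed_triangle => [|i]; first lra.
  apply: filterS (ae_sub i (x0 + x) x0) => w.
  by rewrite addrC addKr => ->; exact: ler_normB.
(* The level 2 n + 1 rather than 2 n, as n may be 0. *)
have N0 : 0 < 2 * n%:R + 1 :> R by rewrite ltr_wpDl.
exists (c / (2 * n%:R + 1) * r) => [|x xr]; first by rewrite mulr_gt0// divr_gt0.
pose a := (2 * n%:R + 1) / c.
have a0 : 0 < a by rewrite divr_gt0.
apply: (le_trans _ (small2 (a *: x) _)); last first.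
  by rewrite normrZ gtr0_norm// -ltr_pdivlMl// invf_div.
apply: pr_mono_ae; [exact: measurable_exceed_some..|].
have /ae_foralln := fun i => U_linear i a x 0.
have /ae_foralln := fun i => U_linear i 1 0 0.
apply: filterS2 => w U0 Ua [i ci]; exists i.
have := Ua i; rewrite addr0 => ->.
have : U i 0 w = 0 by have := U0 i; rewrite scaler0 addr0 mul1r; lra.
move=> ->; rewrite addr0 normrM gtr0_norm//.
apply: (@lt_trans _ _ (a * c)); last by rewrite ltr_pM2l.
by rewrite /a divfK ?gt_eqF// ltrDl.
Qed.

End equicontinuity.

(** * Rademacher averages *)

Section rademacher.
Context (R : realType).

(** All the choices of n signs, as functions equal to 1 from n on, so that a
    pattern of length n extends to one of length n + 1 without change. *)
Fixpoint sign_patterns (n : nat) : seq (nat -> R) :=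
  if n is m.+1 then
    let s := sign_patterns m in
    s ++ [seq (fun k => if k == m then -1 else e k) | e <- s]
  else [:: fun=> 1].

Lemma size_sign_patterns n : size (sign_patterns n) = (2 ^ n)%N.
Proof. by elim: n => //= n IH; rewrite size_cat size_map IH expnS mul2n addnn. Qed.

Lemma sign_patterns_tail n k : (n <= k)%N ->
  all (fun e => e k == 1) (sign_patterns n) : Prop.
Proof.
elim: n => [_|n IH nk]; first by rewrite /= eqxx.
rewrite /= all_cat IH ?(ltnW nk)//= all_map.
apply: sub_all (IH (ltnW nk)) => e /= /eqP ek.
by rewrite gtn_eqF// ek.
Qed.

Definition signed_sum (V : lmodType R) (a : nat -> V) n (e : nat -> R) : V :=
  \sum_(k < n) e k *: a k.

(** The induction step of all moment computations: conditioning on the first n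
    signs. *)
Lemma sum_sign_patternsS (V : lmodType R) (f : V -> R) (a : nat -> V) n :
  \sum_(e <- sign_patterns n.+1) f (signed_sum a n.+1 e) =
  \sum_(e <- sign_patterns n)
    (f (signed_sum a n e + a n) + f (signed_sum a n e - a n)).
Proof.
rewrite /= big_cat big_map [RHS]big_split /=.
have := sign_patterns_tail (leqnn n).
elim: (sign_patterns n) => [|e s IH] /=; first by rewrite !big_nil.
move=> /andP[/eqP en /IH]; rewrite !big_cons => {}IH.
rewrite addrACA IH [in RHS]addrACA; congr (f _ + f _ + _).
  by rewrite /signed_sum big_ord_recr/= en scale1r.
rewrite /signed_sum big_ord_recr/= eqxx scaleN1r; congr (_ - _).
by apply: eq_bigr => i _; rewrite ltn_eqF.
Qed.

(** The cross terms cancel, by the parallelogram identity; this covers both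
    real squares and squared Hilbert norms. *)
Lemma second_moment_signs (V : lmodType R) (f : V -> R) (a : nat -> V) n :
  f 0 = 0 -> (forall u v, f (u + v) + f (u - v) = 2 * f u + 2 * f v) ->
  \sum_(e <- sign_patterns n) f (signed_sum a n e) =
  2 ^+ n * \sum_(k < n) f (a k).
Proof.
move=> f0 fD; elim: n => [|n IH].
  by rewrite /= big_seq1 /signed_sum !big_ord0 f0 mulr0.
rewrite sum_sign_patternsS; under eq_bigr do rewrite fD.
rewrite big_split/= -mulr_sumr IH big_const_seq count_predT iter_addr_0.
rewrite -[X in _ + X]mulr_natr size_sign_patterns natrX big_ord_recr/=.
by rewrite [2 ^+ n.+1]exprS; ring.
Qed.

Lemma second_moment_signsR (a : nat -> R) n :
  \sum_(e <- sign_patterns n) (signed_sum (a : nat -> R^o) n e) ^+ 2 =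
  2 ^+ n * \sum_(k < n) a k ^+ 2.
Proof.
apply: (second_moment_signs (V := R^o) (f := fun v => v ^+ 2)).
  by rewrite expr0n.
by move=> u v; rewrite -[u - v]/(u + - v); ring.
Qed.

(** Khintchine's inequality for the exponent 4, with its sharp constant 3. *)
Lemma fourth_moment_signs (a : nat -> R) n :
  \sum_(e <- sign_patterns n) (signed_sum (a : nat -> R^o) n e) ^+ 4 <=
  2 ^+ n * (3 * (\sum_(k < n) a k ^+ 2) ^+ 2).
Proof.
elim: n => [|n IH].
  by rewrite /= big_seq1 /signed_sum !big_ord0 !expr0n !mulr0.
rewrite (sum_sign_patternsS (V := R^o) (fun v => v ^+ 4)).
set s := signed_sum _ n in IH *.
rewrite (eq_bigr (fun e => 2 * (s e) ^+ 4 +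
  (12 * a n ^+ 2 * (s e) ^+ 2 + 2 * a n ^+ 4))); last first.
  by move=> e _; rewrite -[s e - a n]/(s e + - a n); ring.
rewrite big_split/= -mulr_sumr big_split/= -mulr_sumr second_moment_signsR.
rewrite big_const_seq count_predT iter_addr_0.
rewrite -[X in _ + (_ + X)]mulr_natr size_sign_patterns natrX big_ord_recr/=.
set S := \sum_(i < n) _ in IH *; set N := 2 ^+ n in IH *.
have N0 : 0 <= N by rewrite exprn_ge0.
rewrite [2 ^+ _]exprS -/N.
have : 0 <= N * a n ^+ 4 by rewrite mulr_ge0// exprn_even_ge0.
have -> : 2 * N * (3 * (S + a n ^+ 2) ^+ 2) =
  2 * (N * (3 * S ^+ 2)) + 12 * a n ^+ 2 * (N * S) + 6 * (N * a n ^+ 4) by ring.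
lra.
Qed.

(** With S the sum of the squares, t ^ 2 <= S / 2 + 3 S [c < |t|] + t ^ 4 /
    (12 S) for each real t: either t ^ 2 <= c ^ 2 < S / 2, or the last two
    terms are at least t ^ 2 by the inequality between the arithmetic and
    geometric means. Averaging over the signs, the left side gives S and the
    last term at most S / 4, which leaves S / 4 for the middle one. *)
Lemma paley_zygmund_signs (a : nat -> R) n (c : R) : 0 <= c ->
  2 * c ^+ 2 < \sum_(k < n) a k ^+ 2 ->
  (2 : R) ^+ n / 12 <= \sum_(e <- sign_patterns n)
    (c < `|signed_sum (a : nat -> R^o) n e : R|)%R%:R.
Proof.
move=> c0; set S := \sum_(k < n) _ => cS.
have S0 : 0 < S by apply: le_lt_trans cS; rewrite mulr_ge0// sqr_ge0.
pose s e : R := signed_sum (a : nat -> R^o) n e; set N : R := 2 ^+ n.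
have key e : (s e) ^+ 2 <= S / 2 + 3 * S * (c < `|s e|)%R%:R + (s e) ^+ 4 / (12 * S).
  have s4 : 0 <= (s e) ^+ 4 / (12 * S).
    by rewrite divr_ge0 ?exprn_even_ge0// mulr_ge0// ltW.
  case: ltP => h; last first.
    rewrite mulr0 addr0 ler_wpDr// (@le_trans _ _ (c ^+ 2))//; last lra.
    by rewrite -real_normK ?num_real// ler_pXn2r ?nnegrE.
  rewrite mulr1.
  (* 3 S and s ^ 4 / (12 S) are equal when s ^ 2 = 6 S. *)
  have := sqr_ge0 ((s e) ^+ 2 - 6 * S).
  have -> : ((s e) ^+ 2 - 6 * S) ^+ 2 =
    12 * S * (3 * S + (s e) ^+ 4 / (12 * S) - (s e) ^+ 2).
    by field; rewrite gt_eqF.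
  rewrite pmulr_rge0 ?mulr_gt0//; lra.
have : \sum_(e <- sign_patterns n) s e ^+ 2 <= \sum_(e <- sign_patterns n)
    (S / 2 + 3 * S * (c < `|s e|)%R%:R + s e ^+ 4 / (12 * S)).
  by apply: ler_sum => e _; exact: key.
rewrite second_moment_signsR !big_split/=.
rewrite big_const_seq count_predT iter_addr_0 -mulr_sumr -mulr_suml.
rewrite -[S / 2 *+ _]mulr_natr size_sign_patterns natrX -/N -/S.
have : (\sum_(e <- sign_patterns n) s e ^+ 4) / (12 * S) <= N * S / 4.
  rewrite ler_pdivrMr ?mulr_gt0//.
  have := fourth_moment_signs a n; rewrite -/N -/S.
  have -> : N * S / 4 * (12 * S) = N * (3 * S ^+ 2) by field.
  by [].
set T := \sum_(e <- _) _; set G := \sum_(e <- _) _ => T4 h.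
(* N S <= N S / 2 + 3 S G + N S / 4. *)
have : S * (N / 12) <= S * G by lra.
by rewrite ler_pM2l.
Qed.

End rademacher.

Section square_sums.
Context (R : realType) d (Omega : measurableType d) (P : probability Omega R).
Context (K : completeNormedModType R) (QK : {symmetric K}).
Context (U : nat -> K -> Omega -> R).
Hypothesis QKE : inner_product QK.
Hypothesis mU : forall i x, measurable_fun setT (U i x).
Hypothesis U_linear : forall i a x y,
  {ae P, forall w, U i (a *: x + y) w = a * U i x w + U i y w}.
Hypothesis U_equi : forall c e : R, 0 < c -> 0 < e -> exists2 r : R, 0 < r &
  forall x, `|x| < r -> pr P (exceed_some U c x) <= e.

Lemma ae_signed_sum i (x : nat -> K) n (e : nat -> R) :
  {ae P, forall w, U i (signed_sum x n e) w =
    signed_sum (fun k => U i (x k) w : R^o) n e}.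
Proof.
rewrite /signed_sum; elim: n => [|n IH].
  apply: filterS (U_linear i 1 0 0) => w.
  by rewrite !big_ord0 scaler0 addr0 mul1r; lra.
apply: filterS2 IH (U_linear i (e n) (x n) (\sum_(k < n) e k *: x k)) => w IH.
by rewrite !big_ord_recr/= addrC => ->; rewrite IH addrC.
Qed.

(** If at some time i the squares sum to more than c, then at this same time
    at least a twelfth of the signed sums of the U i (x k) is larger than a
    level b. The signed sum is, almost surely, the value of U i at the signed
    sum of the x k, so the probability of the event is at most 12 times the
    average over the signs of the probability that U exceeds b at that vector.
    For vectors of norm below r it is small by equicontinuity, and the others
    are rare by Chebyshev's inequality, because the mean square norm of a
    signed sum is the sum of the squared norms. *)
Lemma square_sum_equicontinuity (c e : R) : 0 < c -> 0 < e ->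
  exists2 r : R, 0 < r & forall n (x : nat -> K),
    \sum_(k < n) `|x k| ^+ 2 <= r ->
    pr P [set w | exists i, c < \sum_(k < n) (U i (x k) w) ^+ 2] <= e.
Proof.
move=> c0 e0; pose b := Num.sqrt (c / 2).
have c2 : 0 < c / 2 by rewrite divr_gt0.
have b0 : 0 < b by rewrite sqrtr_gt0.
have bE : 2 * b ^+ 2 = c by rewrite sqr_sqrtr ?ltW//; field.
(* Half of e for the short signed sums, half for the long ones, and a factor
   12 from the averaging. *)
have e24 : 0 < e / 24 by rewrite divr_gt0.
have [r r0 hr] := U_equi b0 e24.
exists (r ^+ 2 * (e / 24)) => [|n x xr]; first by rewrite mulr_gt0// exprn_gt0.
set A := [set w | _].
have mA : measurable A.
  rewrite (_ : A = \bigcup_i [set w | c < \sum_(k < n) (U i (x k) w) ^+ 2]).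
    apply: bigcupT_measurable => i; apply: measurable_set_lt => //.
    by apply: measurable_sum => k; apply: measurable_funX.
  by apply/seteqP; split=> [w [i ci]|w [i _ ci]]; exists i.
pose B s := exceed_some U b (signed_sum x n s).
have mB s : measurable (B s) by exact: measurable_exceed_some.
(* Equicontinuity if the signed sum is short; the right side is at least 1
   otherwise. *)
have prB s : pr P (B s) <= e / 24 + `|signed_sum x n s| ^+ 2 / r ^+ 2.
  have [xs|xs] := ltP `|signed_sum x n s| r.
    by rewrite (le_trans (hr _ xs))// lerDl divr_ge0// sqr_ge0.
  rewrite (le_trans (pr_le1 _ (mB s)))// ler_wpDl ?(ltW e24)//.
  by rewrite ler_pdivlMr ?exprn_gt0// mul1r ler_pXn2r// nnegrE// ltW.
have : 2 ^+ n / 12 * pr P A <= \sum_(s <- sign_patterns R n) pr P (B s).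
  apply: pr_average => //.
  have /ae_foralln := fun j => ae_foralln
    (fun i => ae_signed_sum i x n (nth (fun=> 1) (sign_patterns R n) j)).
  apply: filterS => w Uw [i ci].
  rewrite -bE in ci.
  apply: le_trans (@paley_zygmund_signs _ (fun k => U i (x k) w) n b (ltW b0) ci) _.
  rewrite !(big_nth (fun=> 1)); apply: ler_sum => j _.
  rewrite indicE ler_nat; case: ltP => // h.
  by rewrite mem_set//; exists i; rewrite Uw.
move=> hA.
have : \sum_(s <- sign_patterns R n) pr P (B s) <= 2 ^+ n * (e / 12).
  apply: (@le_trans _ _ (\sum_(s <- sign_patterns R n)
     (e / 24 + QK (signed_sum x n s) (signed_sum x n s) / r ^+ 2))).
    by apply: ler_sum => s _; rewrite QKE.
  rewrite big_split/= big_const_seq count_predT iter_addr_0.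
  rewrite -mulr_suml (second_moment_signs (f := fun v => QK v v)); first last.
    by move=> u v; rewrite form_sqrD form_sqrB; ring.
    by rewrite linear0r.
  rewrite -[X in X + _]mulr_natr size_sign_patterns natrX.
  have : (\sum_(k < n) QK (x k) (x k)) / r ^+ 2 <= e / 24.
    rewrite ler_pdivrMr ?exprn_gt0// mulrC.
    by under eq_bigr do rewrite QKE.
  rewrite -(@ler_pM2l _ (2 ^+ n)) ?exprn_gt0//; lra.
move=> /(le_trans hA).
by rewrite -mulrA ler_pM2l ?exprn_gt0//; lra.
Qed.

End square_sums.

(** * Continuous and cadlag paths *)

Section paths.
Context {R : realType}.

Lemma path_comp k (T U : topologicalType) (g : T -> U) (f : R -> T) :
  continuous g -> path_of_kind k f -> path_of_kind k (g \o f).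
Proof.
move=> cg; case: k => /=.
  move=> /subspace_continuousP cf; apply/subspace_continuousP => t t0.
  exact: cvg_comp (cf t t0) (cg (f t)).
move=> [fr fl]; split=> [t t0|t t0]; first exact: cvg_comp (fr t t0) (cg (f t)).
have [l fl'] := fl t t0; exists (g l); exact: cvg_comp fl' (cg l).
Qed.

Lemma path_cst k (T : topologicalType) (c : T) : path_of_kind k (fun _ : R => c).
Proof.
case: k => /=; first by move=> t; exact: cvg_cst.
by split=> [t _|t _]; [exact: cvg_cst|exists c; exact: cvg_cst].
Qed.

Lemma pathD k (E : normedModType R) (f g : R -> E) :
  path_of_kind k f -> path_of_kind k g -> path_of_kind k (fun t => f t + g t).
Proof.
case: k => /=.
  move=> /subspace_continuousP cf /subspace_continuousP cg.
  by apply/subspace_continuousP => t t0; apply: cvgD; [exact: cf|exact: cg].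
move=> [fr fl] [gr gl]; split=> [t t0|t t0].
  by apply: cvgD; [exact: fr|exact: gr].
have [l fl'] := fl t t0; have [m gl'] := gl t t0.
by exists (l + m); exact: cvgD.
Qed.

Lemma path_sum k (E : normedModType R) (f : nat -> R -> R) (e : nat -> E) n :
  (forall i, path_of_kind k (f i : R -> R^o)) ->
  path_of_kind k (fun t => \sum_(0 <= i < n) f i t *: e i).
Proof.
move=> pf; elim: n => [|n IH].
  by under eq_fun do rewrite big_geq//; exact: path_cst.
under eq_fun do rewrite big_nat_recr//=.
apply: pathD => //; apply: (path_comp (g := fun a : R^o => a *: e n)) => //.
exact: scalel_continuous.
Qed.

Lemma path_right k (T : topologicalType) (f : R -> T) : path_of_kind k f ->
  forall t, 0 <= t -> f s @[s --> t^'+] --> f t.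
Proof.
case: k => [/subspace_continuousP cf t t0|[]//].
move=> A /(cf t t0); rewrite /= !near_simpl !near_withinE.
by apply: filterS => s sA ts; apply: sA; exact: le_trans (ltW ts).
Qed.

Lemma near_lt (x y : R) : x < y -> \forall s \near x, s < y.
Proof. by move=> xy; apply: open_nbhs_nbhs; split => //; exact: open_lt. Qed.

Lemma near_gt (x y : R) : y < x -> \forall s \near x, y < s.
Proof. by move=> xy; apply: open_nbhs_nbhs; split => //; exact: open_gt. Qed.

(** Near t, the path is within 1 of its left limit or of its value at t. *)
Lemma path_locally_bounded k (f : R -> R^o) : path_of_kind k f ->
  forall t : R, 0 <= t -> exists M : R, \forall s \near t, 0 <= s -> `|f s| <= M.
Proof.
case: k => /=.
  move=> /subspace_continuousP cf t t0; exists (`|f t| + 1).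
  have /cvgrPdist_le/(_ _ ltr01) := cf t t0; rewrite near_withinE.
  apply: filterS => s h /h; rewrite -lerBlDl; apply: le_trans.
  by rewrite distrC lerB_dist.
move=> [fr fl] t t0.
have /cvgrPdist_le/(_ _ ltr01) := fr t t0; rewrite near_withinE => hr.
have [l hl] : exists l : R, \forall s \near t, 0 <= s -> s < t -> `|l - f s| <= 1.
  have [t00|{}t0] := leP t 0.
    exists 0; apply: (@filterE _ (nbhs t)) => s s0 st.
    by have := le_lt_trans s0 (lt_le_trans st t00); rewrite ltxx.
  have [l /cvgrPdist_le/(_ _ ltr01)] := fl t t0; rewrite near_withinE => h.
  by exists l; apply: filterS h => s h _.
exists (`|f t| + `|l| + 1); apply: filterS2 hr hl => s hr hl s0.
have [ts|ts|->] := ltgtP t s.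
- have := hr ts; have := lerB_dist (f s) (f t); rewrite distrC.
  by have := normr_ge0 l; lra.
- have := hl s0 ts; have := lerB_dist (f s) l; rewrite distrC.
  by have := normr_ge0 (f t); lra.
- by have := normr_ge0 l; have := normr_ge0 (f s); lra.
Qed.

(** Compactness of [0, T]. *)
Lemma path_bounded k (f : R -> R^o) (T : R) : path_of_kind k f ->
  exists M : R, forall t, 0 <= t <= T -> `|f t| <= M.
Proof.
move=> pf.
have := @segment_compact R 0 T; move/compact_near_coveringP.
move=> /(_ R (pinfty_nbhs R) (fun M t => 0 <= t -> `|f t| <= M) _) h.
have [|M [_ hM]] := h.
  move=> t /=; rewrite in_itv/= => /andP[t0 tT].
  have [M hM] := path_locally_bounded pf t0.
  exists ([set s | 0 <= s -> `|f s| <= M], [set N | M <= N]) => /=.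
    by split => //; apply: nbhs_pinfty_ge; exact: num_real.
  by move=> [s N] /= [hs MN] s0; exact: le_trans (hs s0) MN.
exists (M + 1) => t t0T; apply: (hM (M + 1)); first by rewrite ltrDl.
  by rewrite /= in_itv.
by case/andP: t0T.
Qed.

Section uniform_limit.
Context (E : completeNormedModType R) (f : nat -> R -> E) (g : R -> E).
Hypothesis fg : forall T e : R, 0 < e ->
  exists j, forall t, 0 <= t <= T -> `|f j t - g t| <= e.

Lemma uniform_limit_cvg (F : set_system R) (FF : Filter F) (t T : R) :
  0 <= t <= T -> (\forall s \near F, 0 <= s <= T) ->
  (forall j, f j s @[s --> F] --> f j t) -> g s @[s --> F] --> g t.
Proof.
move=> tT FT cf; apply/cvgrPdist_le => e e0.
have e3 : 0 < e / 3 by rewrite divr_gt0.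
have [j hj] := fg T e3.
have /cvgrPdist_le/(_ _ e3) := cf j.
apply: filterS2 FT => s sT h.
have -> : g t - g s = (f j t - f j s) + (f j s - g s) - (f j t - g t).
  by rewrite opprB [RHS]addrC !addrA !subrK.
have := ler_normB ((f j t - f j s) + (f j s - g s)) (f j t - g t).
have := ler_normD (f j t - f j s) (f j s - g s).
have := hj t tT; have := hj s sT; lra.
Qed.

Lemma uniform_limit_is_cvg (F : set_system R) (FF : ProperFilter F) (T : R) :
  (\forall s \near F, 0 <= s <= T) ->
  (forall j, exists l : E, f j s @[s --> F] --> l) ->
  exists l : E, g s @[s --> F] --> l.
Proof.
move=> FT cf; apply/cvg_ex/cauchy_cvgP/cauchy_exP => e e0.
have e3 : 0 < e / 3 by rewrite divr_gt0.
have [j hj] := fg T e3; have [l fl] := cf j; exists l.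
have /cvgrPdist_le/(_ _ e3) := fl.
rewrite !near_simpl; apply: filterS2 FT => s sT h.
rewrite -ball_normE /=.
have -> : l - g s = (l - f j s) + (f j s - g s) by rewrite addrA subrK.
have := ler_normD (l - f j s) (f j s - g s).
have := hj s sT; lra.
Qed.

(** The usual three-epsilon argument for values; left limits exist because the
    limit path is Cauchy along the filter of left neighbourhoods. *)
Lemma path_uniform_limit k : (forall j, path_of_kind k (f j)) ->
  path_of_kind k g.
Proof.
have near_le (t : R) : \forall s \near t, s <= t + 1.
  have h : t < t + 1 by rewrite ltrDl.
  by apply: filterS (near_lt h) => s /ltW.
case: k => /= pf.
  apply/subspace_continuousP => t /= t0.
  apply: (@uniform_limit_cvg _ _ t (t + 1)) => [||j].
  - by rewrite t0/= lerDl.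
  - by rewrite near_withinE; apply: filterS (near_le t) => s st s0; rewrite s0.
  - by have /subspace_continuousP := pf j; exact.
split => t t0.
  apply: (@uniform_limit_cvg _ _ t (t + 1)) => [||j].
  - by rewrite t0/= lerDl.
  - rewrite near_withinE; apply: filterS (near_le t) => s st ts.
    by rewrite st (le_trans t0 (ltW ts)).
  - by have [+ _] := pf j; exact.
apply: (@uniform_limit_is_cvg _ _ t) => [|j]; last by have [_] := pf j; exact.
rewrite near_withinE.
by apply: filterS (near_gt t0) => s s0 st; rewrite !ltW.
Qed.

End uniform_limit.

End paths.

(** * The strong dual *)

Section strong_dual_topology.
Context {R : realType}.

(** The strong topology, spelled out at one bounded set; with
    strong_continuous below, it is the only place where the topology of
    uniform convergence is unfolded. *)
Lemma strong_near (E : tvsType R) (g : strong_dual E) (B : set E) (e : R) :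
  tvs_bounded B -> 0 < e ->
  \forall f \near g, forall h, B h -> `|pairing g h - pairing f h| < e.
Proof.
move=> bB e0.
pose w := fun f : {linear_continuous E -> R^o} =>
  (f : E -> R^o) : {family @tvs_bounded R E, E -> R^o}.
have wc : w f @[f --> (g : initial_topology w)] --> w g.
  exact: (@initial_continuous _ _ w g).
have FF : Filter (w @ nbhs (g : initial_topology w)).
  apply: fmap_filter; exact: nbhs_filter.
have /(fam_cvgP _ _ FF)/(_ B bB) := wc.
move=> /(_ [set f : E -> R^o | forall h, B h -> `|pairing g h - f h| < e]); apply.
apply/uniform_nbhs; exists [set xy : R^o * R^o | `|xy.1 - xy.2| < e]; split.
  by rewrite -entourage_ballE; exists e => // -[x y] /=; rewrite -ball_normE.
by [].
Qed.

Lemma strong_continuous (T : topologicalType) (E : tvsType R)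
    (f : T -> strong_dual E) :
  (forall x B (e : R), tvs_bounded B -> 0 < e -> \forall y \near x,
     forall h, B h -> `|pairing (f x) h - pairing (f y) h| < e) ->
  continuous f.
Proof.
move=> fc; apply: continuous_comp_initial => x.
apply/fam_cvgP => B bB A /uniform_nbhs [V [entV VA]].
have [e /= e0 eV] : exists2 e : R, 0 < e & [set xy : R^o * R^o | ball xy.1 e xy.2] `<=` V.
  by move: entV; rewrite -entourage_ballE.
apply: filterS (fc x B e bB e0) => y xy; apply: VA => h Bh.
by apply: eV; rewrite /= -ball_normE/=; exact: xy.
Qed.

Lemma pairing_ext (E : tvsType R) (f g : strong_dual E) :
  pairing f =1 pairing g -> f = g.
Proof.
case: f => f [[c1] [a1] [s1]]; case: g => g [[c2] [a2] [s2]]; rewrite /pairing /=.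
move=> /funext fg; move: c1 a1 s1 c2 a2 s2; rewrite fg => c1 a1 s1 c2 a2 s2.
by congr (LinearContinuous.Pack (LinearContinuous.Class _ _ _)); 
  congr (_ _); exact: Prop_irrelevance.
Qed.

Lemma linear_continuous_bounded (E F : tvsType R)
  (j : {linear_continuous E -> F}) (B : set E) :
  tvs_bounded B -> tvs_bounded (j @` B).
Proof.
move=> bB U U0.
have /bB[r r0 BU] : nbhs 0 (j @^-1` U).
  by apply: (@cts_fun _ _ j 0); rewrite linear0.
exists r => // _ [x Bx <-]; have [y Uy <-] := BU x Bx.
by exists (j y) => //; rewrite linearZ.
Qed.

(** A continuous linear map sends bounded sets to bounded sets. *)
Lemma adjoint_continuous (E F : tvsType R) (j : {linear_continuous E -> F}) :
  continuous (adjoint j : strong_dual F -> strong_dual E).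
Proof.
apply: strong_continuous => g B e bB e0.
apply: filterS (strong_near g (linear_continuous_bounded j bB) e0) => f h x Bx.
by apply: h; exists x.
Qed.

Lemma tvs_bounded1 (E : tvsType R) (x : E) : tvs_bounded [set x].
Proof.
move=> U U0.
have : (fun a : R^o => a *: x) @ 0 --> 0 *: x.
  apply: (cvg_comp2 (cvg_id) (cvg_cst x) (@scale_continuous R E (0, x))).
rewrite scale0r => /(_ _ U0) /nbhs_ballP[r /= r0 rU].
have r2 : 0 < r / 2 by rewrite divr_gt0.
exists (r / 2)^-1; first by rewrite invr_gt0.
move=> _ ->; exists ((r / 2) *: x).
  apply: rU; rewrite -ball_normE/= sub0r normrN gtr0_norm//.
  by rewrite ltr_pdivrMr// ltr_pMr// ltr1n.
by rewrite scalerA mulVf ?scale1r// gt_eqF.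
Qed.

(** A point is a bounded set. *)
Lemma pairing_continuous (E : tvsType R) (x : E) :
  continuous (fun f : strong_dual E => pairing f x : R^o).
Proof.
move=> g; have FF : Filter (nbhs g) by exact: nbhs_filter.
apply/cvgrPdist_lt => e e0.
by apply: filterS (strong_near g (@tvs_bounded1 E x) e0) => f; apply.
Qed.

End strong_dual_topology.

(** * Borel measurability and separability *)

Section borel.
Context (R : realType) d (Omega : measurableType d).

Lemma borel_measurable_open (T : topologicalType) (Y : Omega -> T) :
  (forall U, open U -> measurable (Y @^-1` U)) -> borel_measurable Y.
Proof.
move=> mY B; apply: (smallest_sub _ _ : <<s open >> `<=`
  [set B | measurable (Y @^-1` B)]) => //.
split => [|A mA|F mF] /=.
- by rewrite preimage_set0.
- by rewrite setTD preimage_setC; exact: measurableC.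
- by rewrite preimage_bigcup; exact: bigcupT_measurable.
Qed.

Lemma borel_measurable_comp (T U : topologicalType) (g : T -> U) (Y : Omega -> T) :
  continuous g -> borel_measurable Y -> borel_measurable (g \o Y).
Proof.
move=> /continuousP cg mY; apply: borel_measurable_open => A oA.
by apply: (mY (g @^-1` A)); apply: sub_sigma_algebra; exact: cg.
Qed.

Lemma borel_measurable_fun (Z : Omega -> R) :
  borel_measurable (Z : Omega -> R^o) -> measurable_fun setT Z.
Proof.
move=> mZ; apply: (measurability _ (RGenOInfty.measurableE R)).
move=> _ [_ [x ->] <-]; rewrite setTI; apply: mZ; apply: sub_sigma_algebra.
exact: interval_open.
Qed.

(** In a separable normed space an open set is a countable union of balls. *)
Lemma borel_measurable_dist (E : normedModType R) (D : nat -> E)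
    (Y : Omega -> E) : dense (range D) ->
  (forall v, measurable_fun setT (fun w => `|v - Y w|)) -> borel_measurable Y.
Proof.
move=> dD mY; apply: borel_measurable_open => U oU.
have -> : Y @^-1` U =
    \bigcup_m \bigcup_(n in [set n | ball (D m) n.+1%:R^-1 `<=` U])
    [set w | `|D m - Y w| < n.+1%:R^-1].
  apply/seteqP; split=> [w /= UYw|w [m _ [n nU /= vY]]]; last first.
    by apply: nU; rewrite -ball_normE.
  have /nbhs_ballP[r /= r0 rU] : nbhs (Y w) U by exact: open_nbhs_nbhs.
  have [n nr] : exists n, n.+1%:R^-1 < r / 2.
    by have [n] := ltr_add_invr (divr_gt0 r0 (ltr0n _ 2)); rewrite add0r; exists n.
  have n0 : 0 < n.+1%:R^-1 :> R by rewrite invr_gt0.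
  have [_ [m _ <-] hm] := dense_normP dD (Y w) n0.
  exists m => //; exists n => /=; last by rewrite distrC.
  move=> u; rewrite -ball_normE/= => vu; apply: rU; rewrite -ball_normE/=.
  have := ler_normD (Y w - D m) (D m - u); rewrite addrA subrK => h.
  by rewrite (le_lt_trans h)// (splitr r) ltrD// (lt_trans _ nr).
apply: bigcupT_measurable => m; apply: bigcup_measurable => n _.
exact: measurable_set_lt.
Qed.

End borel.

Section riesz.
Context (R : realType) (E : normedModType R) (Q : {symmetric E}).
Hypothesis QE : inner_product Q.

Lemma normed_bounded (B : set E) : tvs_bounded B ->
  exists2 M : R, 0 < M & forall h, B h -> `|h| <= M.
Proof.
move=> /(_ (ball 0 1)) [|r r0 BU]; first exact: nbhsx_ballx.
exists r => // h /BU[u]; rewrite -ball_normE/= sub0r normrN => u1 <-.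
by rewrite normrZ gtr0_norm// -[leRHS]mulr1 ler_pM2l// ltW.
Qed.

(** The Cauchy-Schwarz inequality, uniformly over a bounded set. *)
Lemma riesz_map_continuous : exists2 r : E -> strong_dual E, continuous r &
  forall y h, pairing (r y) h = Q y h.
Proof.
have rl y : linear (Q y : E -> R^o) by move=> a u v; rewrite linearDr/= formZr.
have rc y : continuous (Q y : E -> R^o).
  rewrite (_ : (Q y : E -> R^o) = fun x => Q x y).
    exact: inner_product_continuous.
  by apply/funext => x; rewrite formC.
pose r y : strong_dual E := HB.pack_for {linear_continuous E -> R^o}
  (Q y : E -> R^o) (isContinuous.Build _ _ _ (rc y))
  (GRing.isLinear.Build _ _ _ _ _ (rl y)).
exists r => //; apply: strong_continuous => x B e /normed_bounded[M M0 BM] e0.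
have eM : 0 < e / M by rewrite divr_gt0.
have /cvgrPdist_lt/(_ _ eM) := @cvg_id _ (nbhs x).
apply: filterS => y xy h Bh; rewrite /pairing /= -linearBl/=.
apply: (le_lt_trans (inner_product_Cauchy_Schwarz QE _ _)).
apply: (@le_lt_trans _ _ (`|x - y| * M)); first by rewrite ler_wpM2l// BM.
by rewrite -ltr_pdivlMr.
Qed.
End riesz.

Lemma dense_rangeP (R : realType) (E : normedModType R) (I : Type) (D : I -> E) :
  (forall (v : E) (e : R), 0 < e -> exists i, `|v - D i| < e) ->
  dense (range D).
Proof.
move=> h U [v Uv] oU.
have /nbhs_ballP[r /= r0 rU] : nbhs v U by exact: open_nbhs_nbhs.
have [i vi] := h v r r0; exists (D i); split; last by exists i.
by apply: rU; rewrite -ball_normE.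
Qed.

(** Finite rational combinations of the e k, listed through the countability
    of sequences of rationals. *)
Lemma dense_rational_span (R : realType) (E : normedModType R)
    (Q : {symmetric E}) (e : nat -> E) :
  (forall i, `|e i| <= 1) ->
  (forall v, (fun n => \sum_(0 <= k < n) Q v (e k) *: e k) @ \oo --> v) ->
  exists D : nat -> E, dense (range D).
Proof.
move=> e1 ev.
exists (fun m => let s : seq rat := odflt [::] (unpickle m) in
  \sum_(0 <= k < size s) ratr (nth 0 s k) *: e k).
apply: dense_rangeP => v r r0; have r2 : 0 < r / 2 by rewrite divr_gt0.
have /cvgrPdist_lt/(_ _ r2)/filter_ex[n vn] := ev v.
have [dd ddE] : exists dd : R, dd = r / 2 / n.+1%:R by eexists.
have d0 : 0 < dd by rewrite ddE divr_gt0.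
have /choice[q hq] : forall k, exists q : rat, `|Q v (e k) - ratr q| < dd.
  move=> k; have [|q] := @rat_in_itvoo R (Q v (e k) - dd) (Q v (e k)).
    by rewrite ltrBlDr ltrDl.
  rewrite in_itv/= => /andP[h1 h2]; exists q.
  by rewrite ltr_norml; apply/andP; split; lra.
exists (pickle (mkseq q n)); rewrite pickleK /= size_mkseq.
rewrite -(subrK (\sum_(0 <= k < n) Q v (e k) *: e k) v) -addrA.
apply: (le_lt_trans (ler_normD _ _)); rewrite (splitr r) ltrD//.
rewrite -sumrB; apply: (le_lt_trans (ler_norm_sum _ _ _)).
apply: (@le_lt_trans _ _ (\sum_(0 <= k < n) dd)).
  rewrite !big_nat; apply: ler_sum => k /andP[_ kn].
  rewrite nth_mkseq// -scalerBl normrZ -[leRHS]mulr1.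
  by rewrite ler_pM// ltW.
rewrite big_const_nat subn0 iter_addr_0 -[ltLHS]mulr_natr ddE -mulrA.
by rewrite gtr_pMr// mulrC ltr_pdivrMr// mul1r ltr_nat.
Qed.

(** * Uniform convergence of block sums *)

Section path_convergence.
Context (R : realType).

Lemma half_power_small (e : R) : 0 < e -> exists n, (2^-1) ^+ n < e.
Proof.
move=> e0; have [n ne] : exists n : nat, e^-1 < n.+1%:R.
  by exists (Num.truncn e^-1); exact: truncnS_gt.
exists n.+1; rewrite exprVn -[e]invrK ltf_pV2 ?posrE ?invr_gt0 ?exprn_gt0//.
by rewrite (lt_trans ne)// -natrX ltr_nat ltn_expl.
Qed.

(** The partial sums of the geometric series of ratio 1/2 dominate the
    increments. *)
Lemma geometric_cvg (E : completeNormedModType R) (u : nat -> E) J :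
  (forall j, (J <= j)%N -> `|u j.+1 - u j| <= (2^-1) ^+ j) ->
  cvgn u /\ forall j, (J <= j)%N -> `|u j - limn u| <= 2 * (2^-1) ^+ j.
Proof.
move=> uJ.
have step m n : (J <= m)%N -> (m <= n)%N ->
    `|u n - u m| <= 2 * (2^-1) ^+ m - 2 * (2^-1) ^+ n.
  move=> Jm; elim: n => [|n IH]; first
    by rewrite leqn0 => /eqP ->; rewrite !subrr normr0.
  rewrite leq_eqVlt => /predU1P[->|]; first by rewrite !subrr normr0.
  rewrite ltnS => mn; rewrite -(subrK (u n) (u n.+1)) -addrA.
  apply: (le_trans (ler_normD _ _)); have := IH mn.
  by have := uJ n (leq_trans Jm mn); rewrite exprS; lra.
have p0 n : 0 < (2^-1) ^+ n :> R by rewrite exprn_gt0.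
have cu : cvgn u.
  apply: cauchy_seq_cvg => e e0.
  have [n ne] := half_power_small (divr_gt0 e0 (ltr0n R 2)).
  exists (maxn J n) => m k; rewrite geq_max => /andP[Jm nm] mk.
  have := step _ _ Jm mk; have := p0 k.
  have : (2^-1) ^+ m <= (2^-1) ^+ n :> R.
    by rewrite ler_wiXn2l// invf_le1 ?ler1n.
  lra.
split=> // j Jj; rewrite distrC.
have h : (fun n => `|u n - u j|) @ \oo --> `|limn u - u j|.
  by apply: cvg_norm; apply: cvgB => //; exact: cvg_cst.
rewrite -(cvg_lim _ h)//; apply: limr_le; first by apply/cvg_ex; eexists; exact: h.
exists j => // n /= jn; have := step _ _ Jj jn; have := p0 n; lra.
Qed.

(** An enumeration of a dense subset of [0, T]: every index is a legitimate
    time, so no membership condition is carried along. *)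
Definition clamped_rat (T : R) (i : nat) : R :=
  Num.min T (Num.max 0 (ratr (odflt 0 (unpickle i : option rat)))).

Lemma clamped_rat_itv T i : 0 <= T -> 0 <= clamped_rat T i <= T.
Proof.
by move=> T0; rewrite /clamped_rat ge_min lexx le_min T0 le_max lexx.
Qed.

(** A right-continuous path that exceeds c at t < T also exceeds it at a
    rational time of [0, T] slightly later than t. *)
Lemma path_rat_le k (f : R -> R^o) (T c : R) : path_of_kind k f ->
  (forall i, f (clamped_rat T i) <= c) -> forall t, 0 <= t < T -> f t <= c.
Proof.
move=> pf fc t /andP[t0 tT]; have fr := path_right pf t0.
rewrite leNgt; apply/negP => ct.
have : \forall s \near t^'+, c < f s.
  by have := cvgr_gt _ fr _ ct; apply.
move=> /(@filterI _ _ _ _ _ (nbhs_right_lt tT)).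
move=> /nbhs_ballP[r /= r0 hr].
have [q] := @rat_in_itvoo R t (t + r) (ltr_pwDr r0 (lexx t)).
rewrite in_itv/= => /andP[tq qr].
have := hr (ratr q); rewrite -ball_normE/= ltr_norml => /(_ _ tq)[].
  by apply/andP; split; lra.
move=> qT; have := fc (pickle q).
rewrite /clamped_rat pickleK/= (max_idPr _) ?(le_trans t0 (ltW tq))//.
by rewrite (min_idPr _) ?(ltW qT)// => h /(le_lt_trans h); rewrite ltxx.
Qed.

Context (E : completeNormedModType R) (Q : {symmetric E}) (e : nat -> E).
Hypothesis QE : inner_product Q.
Hypothesis e_orth : forall i j, i != j -> Q (e i) (e j) = 0.
Hypothesis e_unit : forall i, e i = 0 \/ `|e i| = 1.

(** The vectors are added in blocks delimited by N, so that the convergence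
    along N can be made geometrically fast. *)
Definition block_sum (z : nat -> R -> R) (N : nat -> nat) j t : E :=
  \sum_(0 <= k < N j) z k t *: e k.

Lemma path_square_sum k (z : nat -> R -> R) m n :
  (forall i, path_of_kind k (z i : R -> R^o)) ->
  path_of_kind k (fun t => \sum_(m <= i < n) z i t ^+ 2 : R^o).
Proof.
move=> pz; elim: n => [|n IH].
  by under eq_fun do rewrite big_geq//; exact: path_cst.
have [mn|mn] := leqP m n; last first.
  by under eq_fun do rewrite big_geq//; exact: path_cst.
under eq_fun do rewrite big_nat_recr//=.
apply: (pathD IH); apply: (path_comp (g := fun a : R^o => a ^+ 2 : R^o)) => //.
exact: exprn_continuous.
Qed.

(** Right continuity extends the bound on a block from rational to all times
    before j, and orthogonality turns the sum of the squares into the norm of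
    the block. Thus the blocks are summable uniformly on bounded time
    intervals, from some index on that depends on the interval. *)
Lemma block_sum_limit k (z : nat -> R -> R) (N : nat -> nat) J :
  {homo N : i j / (i <= j)%N} ->
  (forall i, path_of_kind k (z i : R -> R^o)) ->
  (forall j, (J <= j)%N -> forall i,
     \sum_(N j <= n < N j.+1) z n (clamped_rat j%:R i) ^+ 2 <= ((2^-1) ^+ j) ^+ 2) ->
  (forall t, 0 <= t -> cvgn (fun j => block_sum z N j t)) /\
  path_of_kind k (fun t => limn (fun j => block_sum z N j t)).
Proof.
move=> homN pz zN.
have step j t : (J <= j)%N -> 0 <= t < j%:R ->
    `|block_sum z N j.+1 t - block_sum z N j t| <= (2^-1) ^+ j.
  move=> Jj tj; rewrite /block_sum (big_cat_nat (n := N j) (p := N j.+1))//=; last first.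
    exact: homN.
  rewrite addrAC subrr add0r -(@ler_pXn2r _ 2)// ?nnegrE ?exprn_ge0//.
  apply: (le_trans (orthogonal_sum_le QE e_orth e_unit _ _ _)).
  exact: path_rat_le (path_square_sum (N j) (N j.+1) pz) (zN j Jj) _ tj.
have lim T : exists J', forall t, 0 <= t <= T ->
    cvgn (fun j => block_sum z N j t) /\ forall j, (J' <= j)%N ->
    `|block_sum z N j t - limn (fun j => block_sum z N j t)| <= 2 * (2^-1) ^+ j.
  exists (maxn J (Num.truncn T).+1) => t /andP[t0 tT].
  apply: geometric_cvg => j; rewrite geq_max => /andP[Jj Tj].
  apply: step => //; rewrite t0/= (le_lt_trans tT)// (lt_le_trans (truncnS_gt _))//.
  by rewrite ler_nat.
split=> [t t0|].
  by have [J' /(_ t)] := lim t; rewrite t0 lexx => /(_ isT)[].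
apply: (path_uniform_limit (f := block_sum z N)) => [T r r0|j].
  have [J' hJ] := lim T.
  have [n nr] := half_power_small (divr_gt0 r0 (ltr0n R 2)).
  exists (maxn J' n) => t tT; have [_ h] := hJ t tT.
  have := h (maxn J' n) (leq_maxl _ _).
  have : (2^-1) ^+ (maxn J' n) <= (2^-1) ^+ n :> R.
    by rewrite ler_wiXn2l ?leq_maxr// invf_le1 ?ler1n.
  lra.
exact: path_sum.
Qed.

End path_convergence.

(** * The regularized process *)

(** The Borel-Cantelli lemma. *)
Lemma ae_eventually_not (R : realType) d (Omega : measurableType d)
    (P : probability Omega R) (B : nat -> set Omega) :
  (forall j, measurable (B j)) ->
  (forall j, pr P (B j) <= (2 ^ j.+1)%:R^-1) ->
  {ae P, forall w, exists J, forall j, (J <= j)%N -> ~ B j w}.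
Proof.
move=> mB Bj; exists (lim_sup_set B); split.
- by apply: bigcapT_measurable => n; apply: bigcup_measurable.
- apply: lim_sup_set_cvg0 => //.
  apply: (@le_lt_trans _ _ (\sum_(0 <= j <oo) (1 / (2 ^ j.+1)%:R)%:E)%E).
    have PB j : (P (B j) <= (1 / (2 ^ j.+1)%:R)%:E)%E by rewrite prE// lee_fin div1r.
    by apply: lee_nneseries => // j _; exact: PB.
  exact: le_lt_trans (epsilon_trick0 xpredT ler01) (ltry _).
- move=> w /= /forallNP h n _; apply: contrapT => nB; apply: (h n) => j nj Bw.
  by apply: nB; exists j.
Qed.

(** A sequence that converges in probability has a subsequence that converges
    almost surely. *)
Lemma ae_limits_agree (R : realType) d (Omega : measurableType d)
    (P : probability Omega R) (u : nat -> Omega -> R) (a b : Omega -> R) :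
  (forall n, measurable_fun setT (u n)) -> measurable_fun setT b ->
  {ae P, forall w, (fun n => u n w) @ \oo --> a w} ->
  (forall c e : R, 0 < c -> 0 < e -> exists N, forall n, (N <= n)%N ->
     pr P [set w | c <= `|u n w - b w|] <= e) ->
  {ae P, forall w, a w = b w}.
Proof.
move=> mu mb ua ub.
have /choice[N hN] : forall j, exists N, forall n, (N <= n)%N ->
    pr P [set w | (2^-1) ^+ j <= `|u n w - b w|] <= (2 ^ j.+1)%:R^-1.
  by move=> j; apply: ub; rewrite ?exprn_gt0// invr_gt0 ltr0n expn_gt0.
pose n j := maxn (N j) j.
have mB j : measurable [set w | (2^-1) ^+ j <= `|u (n j) w - b w|].
  by apply: measurable_set_le => //; apply: measurableT_comp => //;
    exact: measurable_funB.
apply: filterS2 (ae_eventually_not mB (fun j => hN j _ (leq_maxl _ _))) ua.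
move=> w [J hJ] uaw; apply/eqP; rewrite -subr_eq0 -normr_le0.
apply/ler_addgt0Pr => r r0; rewrite add0r.
have r2 : 0 < r / 2 by rewrite divr_gt0.
have /cvgrPdist_lt/(_ _ r2)[M _ hM] := uaw.
have [i ir] := half_power_small r2.
pose j := maxn J (maxn M i).
have Jj : (J <= j)%N by rewrite leq_maxl.
have Mj : (M <= n j)%N.
  by rewrite (leq_trans _ (leq_maxr _ _))// /j leq_max leq_max leqnn orbT.
have ij : (2^-1) ^+ j <= (2^-1) ^+ i :> R.
  by rewrite ler_wiXn2l ?invf_le1 ?ler1n// /j !leq_max leqnn !orbT.
have /negP := hJ j Jj; rewrite -ltNge => h1; have h2 := hM _ Mj.
have := ler_normD (a w - u (n j) w) (u (n j) w - b w); rewrite addrA subrK.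
by rewrite /= in h2; lra.
Qed.

Section regularized_process.
Context (R : realType) d (Omega : measurableType d) (P : probability Omega R).
Context (K : completeNormedModType R) (QK : {symmetric K}).
Hypothesis QKE : inner_product QK.
Context (k : path_kind) (W : R -> K -> Omega -> R).
Hypothesis mW : forall t y, measurable_fun setT (W t y).
Hypothesis W_linear : forall t a x y, 0 <= t ->
  {ae P, forall w, W t (a *: x + y) w = a * W t x w + W t y w}.
Hypothesis W_cts : forall t (c e : R), 0 <= t -> 0 < c -> 0 < e ->
  exists2 r : R, 0 < r & forall x, `|x| < r ->
    pr P [set w | c <= `|W t x w|] <= e.
Hypothesis W_paths : forall y, exists2 Z : R -> Omega -> R,
  process_of_kind P k (Z : R -> Omega -> R^o) &
  forall t, 0 <= t -> {ae P, forall w, Z t w = W t y w}.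

Lemma ae_bounded_clamped_rat (T : R) y : 0 <= T ->
  {ae P, forall w, exists M, forall i, `|W (clamped_rat T i) y w| <= M}.
Proof.
move=> T0; have [Z [_ pZ] ZW] := W_paths y.
have /ae_foralln := fun i => ZW _ (andP (clamped_rat_itv i T0)).1.
apply: filterS2 pZ => w pZ Zw.
have [M ZM] := path_bounded T pZ; exists M => i.
by rewrite -Zw; apply: ZM; exact: clamped_rat_itv.
Qed.

(** Combines the Baire argument and the Rademacher averages, for the times of
    a bounded interval; the block is shifted to start at 0. *)
Lemma pr_square_sums_small (T c e : R) : 0 <= T -> 0 < c -> 0 < e ->
  exists2 r : R, 0 < r & forall (x : nat -> K) m n,
    \sum_(m <= i < n) `|x i| ^+ 2 <= r ->
    pr P [set w | exists i,
      c < \sum_(m <= j < n) (W (clamped_rat T i) (x j) w) ^+ 2] <= e.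
Proof.
move=> T0 c0 e0.
have T_ge0 i : 0 <= clamped_rat T i by case/andP: (clamped_rat_itv i T0).
have [r r0 hr] := square_sum_equicontinuity QKE
  (U := fun i => W (clamped_rat T i)) (P := P) (fun i x => mW _ x)
  (fun i a x y => W_linear a x y (T_ge0 i))
  (equicontinuity (fun i x => mW _ x) (fun i a x y => W_linear a x y (T_ge0 i))
    (fun i c e => W_cts (T_ge0 i)) (fun x => ae_bounded_clamped_rat x T0)) c0 e0.
exists r => // x m n xr.
have shift (F : nat -> R) : \sum_(j < n - m) F (j + m)%N = \sum_(m <= j < n) F j.
  by rewrite -[in RHS](add0n m) big_addn big_mkord.
have := hr (n - m)%N (fun i => x (i + m)%N).
rewrite (shift (fun i => `|x i| ^+ 2)) => /(_ xr).
congr (pr P _ <= _); apply/seteqP; split => w [i wi]; exists i; move: wi;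
  by rewrite (shift (fun j => W _ (x j) w ^+ 2)).
Qed.
Context (E : completeNormedModType R) (Q : {symmetric E}) (e : nat -> E).
Hypothesis QE : inner_product Q.
Hypothesis e_orth : forall i j, i != j -> Q (e i) (e j) = 0.
Hypothesis e_unit : forall i, e i = 0 \/ `|e i| = 1.

(** By orthogonality the squared distance is a polynomial in the coordinates.
    *)
Lemma measurable_dist_orthogonal_sum (z : nat -> Omega -> R) n v :
  (forall i, measurable_fun setT (z i)) ->
  measurable_fun setT (fun w => `|v - \sum_(0 <= i < n) z i w *: e i|).
Proof.
move=> mz.
rewrite (_ : (fun w => _) = (fun w => Num.sqrt (`|v| ^+ 2
  - 2 * (\sum_(0 <= i < n) z i w * Q v (e i))
  + \sum_(0 <= i < n) (z i w * `|e i|) ^+ 2))); last first.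
  apply/funext => w; rewrite -(normsq_orthogonal_sum QE e_orth) -[LHS]ger0_norm//.
  rewrite -sqrtr_sqr; congr (Num.sqrt _).
  rewrite -!QE form_sqrB form_sumr; congr (_ - _ * _ + _).
  by apply: eq_bigr => i _; rewrite formZr.
apply: (measurableT_comp (f := @Num.sqrt R)).
  by apply: continuous_measurable_fun; exact: sqrt_continuous.
apply: measurable_funD; last first.
  apply: measurable_sum => i; apply: measurable_funX.
  exact: measurable_funM.
apply: measurable_funB => //; apply: measurable_funM => //.
by apply: measurable_sum => i; apply: measurable_funM.
Qed.

Lemma ae_sub_lincomb t z (c : nat -> R) (x : nat -> K) n : 0 <= t ->
  {ae P, forall w, W t (z - \sum_(0 <= i < n) c i *: x i) w =
    W t z w - \sum_(0 <= i < n) c i * W t (x i) w}.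
Proof.
move=> t0; elim: n => [|n IH].
  by apply: aeW => w; rewrite !big_geq// !subr0.
apply: filterS2 IH (W_linear (- c n) (x n) (z - \sum_(0 <= i < n) c i *: x i) t0).
move=> w IH; rewrite !big_nat_recr//= IH => WS.
rewrite opprD addrA [_ - c n *: _]addrC -scaleNr WS; ring.
Qed.

(** With Z i a version of the process at x i having good paths, y t is the sum
    of the Z i t times e i. The sum over i > n is small in the norm of E,
    uniformly in time and in probability, since its squared norm is controlled
    by the tail of the sum of the squared norms of the x i. Blocks chosen so
    that the j-th is small with an error probability summable in j converge
    almost surely, by the Borel-Cantelli lemma. *)
Lemma regularized_process_exists (x : nat -> K) (C : R) :
  (forall n, \sum_(0 <= i < n) `|x i| ^+ 2 <= C) ->
  exists y : R -> Omega -> E,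
  [/\ forall t v, 0 <= t -> measurable_fun setT (fun w => `|v - y t w|),
      {ae P, forall w, path_of_kind k (y ^~ w)} &
      forall t h z, 0 <= t ->
        (fun n => \sum_(0 <= i < n) Q h (e i) *: x i) @ \oo --> z ->
        {ae P, forall w, Q (y t w) h = W t z w}].
Proof.
move=> xC.
have /choice[Z hZ] : forall i, exists Z : R -> Omega -> R,
    process_of_kind P k (Z : R -> Omega -> R^o) /\
    forall t, 0 <= t -> {ae P, forall w, Z t w = W t (x i) w}.
  by move=> i; have [Z ? ?] := W_paths (x i); exists Z.
have mZ i t : 0 <= t -> measurable_fun setT (Z i t).
  by move=> t0; apply: borel_measurable_fun; exact: (hZ i).1.1.
(* The event that the block from m to n is not small on [0, j]. *)
pose B m n j := [set w | exists i, ((2^-1) ^+ j) ^+ 2 <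
      \sum_(m <= l < n) (W (clamped_rat j%:R i) (x l) w) ^+ 2].
have mB m n j : measurable (B m n j).
  rewrite (_ : B m n j = \bigcup_i [set w | ((2^-1) ^+ j) ^+ 2 <
      \sum_(m <= l < n) (W (clamped_rat j%:R i) (x l) w) ^+ 2]).
    apply: bigcupT_measurable => i; apply: measurable_set_lt => //.
    by apply: measurable_sum => l; exact: measurable_funX.
  by apply/seteqP; split=> [w [i wi]|w [i _ wi]]; exists i.
have /choice[N0 hN0] : forall j, exists N0, forall m n, (N0 <= m)%N ->
    (m <= n)%N -> pr P (B m n j) <= (2 ^ j.+1)%:R^-1.
  move=> j; have [|||r r0 hr] :=
      @pr_square_sums_small j%:R (((2^-1) ^+ j) ^+ 2) (2 ^ j.+1)%:R^-1.
  - by [].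
  - by rewrite !exprn_gt0.
  - by rewrite invr_gt0 ltr0n expn_gt0.
  have [M hM] := bounded_series_tail (fun i => sqr_ge0 `|x i|) xC r0.
  by exists M => m n Mm mn; apply: hr; apply/ltW; exact: hM.
(* A sum rather than N0 itself, to make N increase to infinity. *)
pose N j := (\sum_(0 <= i < j.+1) (N0 i).+1)%N.
have NS j : N j.+1 = (N j + (N0 j.+1).+1)%N by rewrite /N big_nat_recr.
have homN : {homo N : i j / (i <= j)%N}.
  by apply: homo_leq => // [i j l|j]; [exact: leq_trans|rewrite NS leq_addr].
have N_ge j : (j < N j)%N.
  elim: j => [|j IH]; first by rewrite /N big_nat1.
  by rewrite NS -addn1 leq_add.
have N0N j : (N0 j <= N j)%N by rewrite /N big_nat_recr//= addnS leqW// leq_addl.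
have good : {ae P, forall w,
    [/\ forall i, path_of_kind k (Z i ^~ w : R -> R^o),
       forall i j l, Z i (clamped_rat j%:R l) w = W (clamped_rat j%:R l) (x i) w &
       exists J, forall j, (J <= j)%N -> ~ B (N j) (N j.+1) j w]}.
  have h1 := ae_foralln (fun i => (hZ i).1.2).
  have h2 := ae_foralln (fun i => ae_foralln (fun j => ae_foralln (fun l =>
    (hZ i).2 _ (andP (clamped_rat_itv l (ler0n R j))).1))).
  have h3 := ae_eventually_not (fun j => mB (N j) (N j.+1) j)
    (fun j => hN0 j _ _ (N0N j) (homN _ _ (leqnSn j))).
  by apply: filterS3 h1 h2 h3.
(* A measurable null set D outside of which all is well; y is 0 on it. *)
have [D [mD D0 subD]] := good.
have goodD w : ~ D w -> [/\ forall i, path_of_kind k (Z i ^~ w : R -> R^o),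
   (forall t, 0 <= t -> cvgn (fun j => block_sum e (fun i t => Z i t w) N j t)) &
   path_of_kind k (fun t => limn (fun j => block_sum e (fun i t => Z i t w) N j t))].
  move=> Dw; have [pZ ZW [J hJ]] : [/\ forall i, path_of_kind k (Z i ^~ w : R -> R^o),
       forall i j l, Z i (clamped_rat j%:R l) w = W (clamped_rat j%:R l) (x i) w &
       exists J, forall j, (J <= j)%N -> ~ B (N j) (N j.+1) j w].
    by apply: contrapT => h; apply: Dw; exact: subD.
  have [] := block_sum_limit QE e_orth e_unit (J := J) homN pZ _.
    move=> j Jj l; rewrite leNgt; apply/negP => h; apply: (hJ j Jj); exists l.
    by under eq_bigr do rewrite -ZW.
  by [].
pose y t w : E := if w \in D then 0
  else limn (fun j => block_sum e (fun i t => Z i t w) N j t).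
exists y; split.
- move=> t v t0.
    (* Multiplying the coordinates by the indicator makes the convergence to y
     hold everywhere. *)
pose z i w := \1_(~` D) w * Z i t w.
  have mz i : measurable_fun setT (z i).
    by apply: measurable_funM; [exact/measurable_indicP/measurableC|exact: mZ].
  apply: (@measurable_fun_cvg _ _ _ _
    (fun j w => `|v - \sum_(0 <= i < N j) z i w *: e i|)).
    by move=> j; exact: measurable_dist_orthogonal_sum.
  move=> w _; rewrite /y /z indicE in_setC; case: (boolP (w \in D)) => [_|].
    apply: cvg_near_cst; apply: nearW => j; rewrite big1 ?subr0// => i _.
    by rewrite mul0r scale0r.
  rewrite notin_setE => /goodD[_ /(_ t t0) cy _].
  apply: cvg_norm; apply: cvgB; first exact: cvg_cst.
  apply: cvg_trans cy; apply: near_eq_cvg; apply: nearW => j.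
  by apply: eq_bigr => i _; rewrite mul1r.
- exists D; split => // w /=; apply: contra_notP => /[dup] Dw /goodD[_ _].
  congr (path_of_kind _ _); apply/funext => t.
  by rewrite /y memNset.
- move=> t h z t0 hz.
  pose u j w := \sum_(0 <= i < N j) Z i t w * Q h (e i).
  apply: (@ae_limits_agree _ _ _ P u).
  + by move=> j; apply: measurable_sum => i; apply: measurable_funM => //; exact: mZ.
  + exact: mW.
  + exists D; split => // w /=; apply: contra_notP => Dw.
    rewrite /y memNset//; have [_ /(_ t t0) cy _] := goodD w Dw.
    have := cvg_comp _ _ cy (@inner_product_continuous _ _ _ QE h _).
    apply: cvg_trans; apply: near_eq_cvg; apply: nearW => j /=.
    by rewrite form_suml; apply: eq_bigr => i _; rewrite formZl formC.
  + move=> c r c0 r0; have [s s0 hs] := W_cts t0 c0 r0.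
    have /cvgrPdist_lt/(_ _ s0)[M _ hM] := hz.
    exists M => j Mj.
    have Mz : `|z - \sum_(0 <= i < N j) Q h (e i) *: x i| < s.
      by apply: hM => /=; exact: leq_trans Mj (ltnW (N_ge j)).
    apply: le_trans (hs _ Mz); apply: pr_mono_ae.
    * apply: measurable_set_le => //; apply: measurableT_comp => //.
      apply: measurable_funB => //; apply: measurable_sum => i.
      by apply: measurable_funM => //; exact: mZ.
    * by apply: measurable_set_le => //; exact: measurableT_comp.
    have ZW := ae_foralln (fun i => (hZ i).2 t t0).
    apply: filterS2 ZW (ae_sub_lincomb z (fun i => Q h (e i)) x (N j) t0).
    move=> w ZW /= ->; rewrite distrC; congr (_ <= `| _ - _ |).
    by apply: eq_bigr => i _; rewrite ZW mulrC.
Qed.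

End regularized_process.

(** * Uniqueness *)

Section uniqueness.
Context (R : realType) (Phi : tvsType R).

Lemma seminorm_approx (q : Phi -> R) : separable_seminorm q ->
  exists (H : completeNormedModType R) (i : {linear Phi -> H}) (D : set H)
    (g : H -> nat),
  [/\ forall phi, `|i phi| = q phi, {in D &, injective g} &
      forall (phi : Phi) (e : R), 0 < e -> exists2 a, D a & `|i phi - a| < e].
Proof.
move=> [H [i [[iq _] [D /(countable_injP _)[g ginj] dD]]]].
by exists H, i, D, g; split => // phi e e0; exact: dense_normP.
Qed.

(** A dense subset of a completion need not meet the image of Phi, so one
    point of Phi is chosen close to each pair of elements of the two dense
    sets, at each scale, whenever there is such a point. *)
Lemma separable_seminorm_pair (q1 q2 : Phi -> R) :
  separable_seminorm q1 -> separable_seminorm q2 ->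
  exists D : nat -> Phi, forall (phi : Phi) (e : R), 0 < e ->
    exists m, q1 (phi - D m) < e /\ q2 (phi - D m) < e.
Proof.
move=> /seminorm_approx[H1 [i1 [D1 [g1 [iq1 g1inj app1]]]]].
move=> /seminorm_approx[H2 [i2 [D2 [g2 [iq2 g2inj app2]]]]].
(* close n psi: psi is within 2 ^ - m of a pair of dense elements, n being the
   code of the pair and m. *)
pose close n psi := exists a b m, [/\ D1 a, D2 b, n = pickle (g1 a, g2 b, m),
  `|i1 psi - a| < (2^-1) ^+ m & `|i2 psi - b| < (2^-1) ^+ m].
have /choice[D hD] : forall n, exists psi, (exists psi', close n psi') -> close n psi.
  move=> n; have [[psi h]|h] := pselect (exists psi', close n psi').
    by exists psi.
  by exists 0 => /h.
exists D => phi e e0.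
have [m me] := half_power_small (divr_gt0 e0 (ltr0n R 2)).
have m0 : 0 < (2^-1) ^+ m :> R by rewrite exprn_gt0.
have [a Da pa] := app1 phi _ m0; have [b Db pb] := app2 phi _ m0.
have : close (pickle (g1 a, g2 b, m)) (D (pickle (g1 a, g2 b, m))).
  by apply: hD; exists phi, a, b, m.
move=> [a' [b' [m' [Da' Db' /(pcan_inj pickleK)[ga gb mm]]]]].
move/g1inj: ga => <-; rewrite ?inE//; move/g2inj: gb => <-; rewrite ?inE// -mm.
move=> h1 h2; exists (pickle (g1 a, g2 b, m)).
rewrite -iq1 -iq2 !linearB/=; split.
  rewrite -(subrK a (i1 phi)) -addrA (le_lt_trans (ler_normD _ _))//.
  by rewrite [`|a - _|]distrC; lra.
rewrite -(subrK b (i2 phi)) -addrA (le_lt_trans (ler_normD _ _))//.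
by rewrite [`|b - _|]distrC; lra.
Qed.

(** A functional on the completion is small on a neighbourhood of 0, which
    contains a ball of finitely many of the seminorms, hence of the largest
    one. *)
Lemma completion_dual_continuous (q : nat -> Phi -> R) (E : tvsType R)
    (j : {linear_continuous Phi -> E}) (f : strong_dual Phi) :
  (forall phi, nondecreasing_seq (q ^~ phi)) ->
  tvs_completion (seminorm_nbhs0 (range q)) j -> range (adjoint j) f ->
  forall e : R, 0 < e -> exists N (r : R), 0 < r /\
    forall phi, q N phi < r -> `|pairing f phi| < e.
Proof.
move=> qincr [_ _ thetaE] [F _ <-] e e0.
have [n [p [r [pq r0 hr]]]] : seminorm_nbhs0 (range q)
    [set phi | `|pairing (adjoint j F) phi| < e].
  rewrite thetaE; exists [set x | `|pairing F x| < e] => //.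
  have /cvgrPdist_lt/(_ _ e0) := @cts_fun _ _ (F : {linear_continuous E -> R^o}) 0.
  by apply: filterS => x; rewrite linear0 sub0r normrN.
have /choice[idx idxE] : forall i, exists N, q N = p i.
  by move=> i; have [N _ <-] := pq i; exists N.
exists (\max_i idx i), r; split => // phi qr; apply: hr => i /=.
rewrite -idxE; apply: le_lt_trans qr; apply: qincr.
exact: leq_bigmax.
Qed.

Context d (Omega : measurableType d) (P : probability Omega R).

Definition regular_variable (Y : Omega -> strong_dual Phi) : Prop :=
  exists theta, countably_hilbertian theta /\
    exists (E : tvsType R) (j : {linear_continuous Phi -> E}),
      tvs_completion theta j /\ {ae P, forall w, range (adjoint j) (Y w)}.

(** Almost surely both values are continuous for countably Hilbertian
    topologies, and the supremum of two such topologies is separable: the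
    pairings at countably many points determine the values. *)
Lemma regular_variable_ext (Y1 Y2 : Omega -> strong_dual Phi) :
  regular_variable Y1 -> regular_variable Y2 ->
  (forall phi, {ae P, forall w, pairing (Y1 w) phi = pairing (Y2 w) phi}) ->
  {ae P, forall w, Y1 w = Y2 w}.
Proof.
move=> [_ [[q1 [hq1 q1incr ->]] [E1 [j1 [c1 rY1]]]]].
move=> [_ [[q2 [hq2 q2incr ->]] [E2 [j2 [c2 rY2]]]]] Y12.
have /choice[D hD] : forall NM : nat * nat, exists D : nat -> Phi,
    forall (phi : Phi) (e : R), 0 < e ->
    exists m, q1 NM.1 (phi - D m) < e /\ q2 NM.2 (phi - D m) < e.
  by move=> [N M]; apply: separable_seminorm_pair; [case: (hq1 N)|case: (hq2 M)].
have Y12D := ae_foralln (fun N => ae_foralln (fun M => ae_foralln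
  (fun m => Y12 (D (N, M) m)))).
apply: filterS3 Y12D rY1 rY2 => w Y12D rY1 rY2.
apply: pairing_ext => phi; apply/eqP; rewrite -subr_eq0 -normr_le0.
apply/ler_addgt0Pr => e e0; rewrite add0r.
have e2 : 0 < e / 2 by rewrite divr_gt0.
have [N [r [r0 hr]]] := completion_dual_continuous q1incr c1 rY1 e2.
have [M [s [s0 hs]]] := completion_dual_continuous q2incr c2 rY2 e2.
have rs0 : 0 < Num.min r s by rewrite lt_min r0.
have [m []] := hD (N, M) phi _ rs0; rewrite !lt_min /=.
move=> /andP[/hr h1 _] /andP[_ /hs h2].
have pB (f : strong_dual Phi) a b : pairing f (a - b) = pairing f a - pairing f b.
  by rewrite /pairing linearB.
rewrite pB in h1; rewrite pB -Y12D in h2; rewrite distrC in h2.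
have := ler_normD (pairing (Y1 w) phi - pairing (Y1 w) (D (N, M) m))
  (pairing (Y1 w) (D (N, M) m) - pairing (Y2 w) phi).
rewrite addrA subrK; lra.
Qed.

(** Almost surely the two processes agree at all rational times, and pairings
    with a fixed vector are right-continuous. *)
Lemma indistinguishable_of_ae_eq k (Z1 Z2 : R -> Omega -> strong_dual Phi) :
  {ae P, forall w, path_of_kind k (Z1 ^~ w)} ->
  {ae P, forall w, path_of_kind k (Z2 ^~ w)} ->
  (forall t, 0 <= t -> {ae P, forall w, Z1 t w = Z2 t w}) ->
  indistinguishable P Z1 Z2.
Proof.
move=> p1 p2 Z12.
have Z12r := ae_foralln (fun j => ae_foralln (fun i =>
  Z12 _ (andP (clamped_rat_itv i (ler0n R j))).1)).
apply: filterS3 Z12r p1 p2 => w Z12r p1 p2 t t0.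
apply: pairing_ext => phi; apply/eqP; rewrite -subr_eq0 -normr_le0.
have pphi (Z : R -> Omega -> strong_dual Phi) : path_of_kind k (Z ^~ w) ->
    path_of_kind k (fun t => pairing (Z t w) phi : R^o).
  by move=> pZ; have := path_comp (@pairing_continuous R Phi phi) pZ; exact.
have pd : path_of_kind k
    (fun t => `|pairing (Z1 t w) phi - pairing (Z2 t w) phi| : R^o).
  apply: (path_comp (g := fun a : R^o => `|a| : R^o)); first exact: norm_continuous.
  apply: pathD; first exact: pphi.
  apply: (path_comp (g := fun a : R^o => - a : R^o)); first exact: opp_continuous.
  exact: pphi.
have tt : 0 <= t < (Num.truncn t).+1%:R by rewrite t0 truncnS_gt.
apply: (path_rat_le pd _ tt) => i.
by rewrite Z12r subrr normr0.
Qed.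

End uniqueness.

(** * Cylindrical processes and Fourier transforms *)

Section cylindrical.
Context (R : realType) d (Omega : measurableType d) (P : probability Omega R).

Lemma complex_norm_ge_Re (z : R[i]) (e : R) : `|z| < e%:C%C -> `|complex.Re z| < e.
Proof.
case: z => a b; rewrite normc_def /= ltcR; apply: le_lt_trans.
by rewrite -sqrtr_sqr ler_wsqrtr// lerDl sqr_ge0.
Qed.

Lemma ae_eqE (f g : Omega -> R) :
  f = g %[ae P] <-> {ae P, forall w, f w = g w}.
Proof. by split; apply: filterS => w h //; exact: h. Qed.

Lemma ae_eq_Rintegral (f g : Omega -> R) :
  measurable_fun setT f -> measurable_fun setT g ->
  {ae P, forall w, f w = g w} -> \int[P]_w f w = \int[P]_w g w.
Proof.
move=> mf mg fg; rewrite /Rintegral; congr fine.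
apply: ae_eq_integral => //; [exact/measurable_EFinP|exact/measurable_EFinP|].
by apply: filterS fg => w -> _.
Qed.

Context (Psi : tvsType R) (X : R -> Psi -> {mfun_ P, Omega >-> measurableTypeR R}).
Hypothesis X_cylindrical : cylindrical_process X.

Lemma cylindrical_measurable t psi : measurable_fun setT (X t psi).
Proof. exact: measurable_funPT. Qed.

Lemma cylindrical_linear t a phi psi : 0 <= t ->
  {ae P, forall w, X t (a *: phi + psi) w = a * X t phi w + X t psi w}.
Proof. by move=> t0; have /ae_eqE := X_cylindrical t0 a phi psi. Qed.

Lemma cylindrical0 t : 0 <= t -> {ae P, forall w, X t 0 w = 0}.
Proof.
move=> t0; apply: filterS (cylindrical_linear 1 0 0 t0) => w.
by rewrite scaler0 addr0; lra.
Qed.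

Lemma cylindricalZ t a psi : 0 <= t ->
  {ae P, forall w, X t (a *: psi) w = a * X t psi w}.
Proof.
move=> t0; apply: filterS2 (cylindrical0 t0) (cylindrical_linear a psi 0 t0) => w.
by rewrite addr0 => -> ->; rewrite addr0.
Qed.

Hypothesis X_fourier : forall T : R, 0 < T ->
  fourier_equicontinuous0 X [set t | 0 <= t <= T].

Lemma measurable_cos_comp (Z : Omega -> R) : measurable_fun setT Z ->
  measurable_fun setT (fun w => cos (Z w)).
Proof.
move=> mZ; apply: (measurableT_comp (f := @cos R)) => //.
by apply: continuous_measurable_fun; exact: continuous_cos.
Qed.

Lemma fourier_near t (e : R) : 0 <= t -> 0 < e ->
  \forall psi \near (0 : Psi), 1 - e <= \int[P]_w cos (X t psi w).
Proof.
move=> t0 e0; have t1 : 0 < t + 1 by rewrite ltr_wpDl.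
apply: filterS (X_fourier t1 e0) => psi /(_ t).
have -> : fourier (X t) 0 = 1.
  rewrite /fourier; congr Complex.
    rewrite (@ae_eq_Rintegral _ (fun=> 1)).
    - by rewrite Rintegral_cst//= probability_setT/= mulr1.
    - exact/measurable_cos_comp/cylindrical_measurable.
    - by [].
    - by apply: filterS (cylindrical0 t0) => w ->; rewrite cos0.
  rewrite (@ae_eq_Rintegral _ (fun=> 0)).
  - by rewrite Rintegral_cst//= mul0r.
  - apply: (measurableT_comp (f := @sin R)); last exact: cylindrical_measurable.
    by apply: continuous_measurable_fun; exact: continuous_sin.
  - by [].
  - by apply: filterS (cylindrical0 t0) => w ->; rewrite sin0.
have tt : [set s | 0 <= s <= t + 1] t by rewrite /= t0 lerDl ler01.
move=> /(_ tt)/complex_norm_ge_Re /=; rewrite distrC => h.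
have := ler_norm (1 - \int[P]_w cos (X t psi w)); lra.
Qed.

(** The Fourier estimate at x also holds at s x for s in [0, 1], where by
    linearity it is an estimate on the Fourier transform of the real random
    variable X (j x) at s; this is what the tail bound requires. Linearity
    also rescales the level. *)
Lemma cylindrical_continuous (K : normedModType R) (j : {linear K -> Psi}) :
  {for 0, continuous j} ->
  forall t (c e : R), 0 <= t -> 0 < c -> 0 < e -> exists2 r : R, 0 < r &
    forall x, `|x| < r -> pr P [set w | c <= `|X t (j x) w|] <= e.
Proof.
move=> cj t c e t0 c0 e0; have e2 : 0 < e / 2 by rewrite divr_gt0.
have : \forall x \near (0 : K), 1 - e / 2 <= \int[P]_w cos (X t (j x) w).
  by have := cj _; rewrite linear0 => /(_ _ (fourier_near t0 e2)).
move=> /nbhs_ballP[r /= r0 rK].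
pose b := 4 / cos 1 : R.
have b0 : 0 < b by rewrite divr_gt0// cos1_gt0.
exists (r * (c / b)) => [|x xr]; first by rewrite mulr_gt0// divr_gt0.
have mX y : measurable_fun setT (fun w => `|X t y w|).
  by have := cylindrical_measurable t y; exact: measurableT_comp.
have [a aE] : exists a, a = b / c by eexists.
have a0 : 0 < a by rewrite aE divr_gt0.
apply: (@le_trans _ _ (pr P [set w | b <= `|X t (j (a *: x)) w|])).
  apply: pr_mono_ae; [exact: measurable_set_le|exact: measurable_set_le|].
  apply: filterS (cylindricalZ a (j x) t0) => w + /= cw.
  rewrite linearZ/= => ->; rewrite normrM gtr0_norm//.
  by rewrite -ler_pdivrMl// aE invf_div divfK// gt_eqF.
apply: (@le_trans _ _ (2 * (e / 2))); last by rewrite mulrC divfK.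
apply: fourier_tail_bound; first exact: cylindrical_measurable.
move=> s /andP[s0 s1].
have : ball 0 r (s *: (a *: x)).
  rewrite -ball_normE/= sub0r normrN !normrZ (ger0_norm s0) (gtr0_norm a0).
  apply: (@le_lt_trans _ _ (a * `|x|)).
    by rewrite ler_piMl// mulr_ge0// ltW.
  by rewrite -ltr_pdivlMl// aE invf_div mulrC.
move=> /rK /=; congr (_ <= _).
apply: ae_eq_Rintegral.
- exact/measurable_cos_comp/cylindrical_measurable.
- apply: measurable_cos_comp; apply: measurable_funM => //.
  exact: cylindrical_measurable.
apply: filterS (cylindricalZ s (j (a *: x)) t0) => w.
by rewrite [j (s *: _)]linearZ/= => ->.
Qed.

End cylindrical.

(** * Discs and Hilbertian completions *)

Section disc_space.
Context (R : realType) (Psi : tvsType R).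

(** The ball of radius l of the space of a bounded disc B lies in the
    multiples of B by reals less than l, which are absorbed by any
    neighbourhood for small l. *)
Lemma disc_space_continuous (B : set Psi) (K : normedModType R)
    (j : {linear K -> Psi}) :
  B 0 -> tvs_bounded B -> disc_space B j -> {for 0, continuous j}.
Proof.
move=> B0 bB [_ jB jN] U; rewrite linear0 => U0.
have := @scale_continuous R Psi (0, 0) U; rewrite /= scale0r => /(_ U0).
move=> [[V1 V2] /= [/nbhs_ballP[d /= d0 dV] V20] VU].
have [s s0 BV] := bB _ V20.
apply/nbhs_ballP; exists (d / s) => /=; first by rewrite divr_gt0.
move=> x; rewrite -ball_normE/= sub0r normrN jN => xd.
have : range j (j x) by exists x.
rewrite jB => -[n _ [b Bb nb]].
have inf_ds : has_inf [set l : R | 0 < l /\ ( *:%R l @` B) (j x)].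
  split; last by exists 0 => l [/ltW].
  case: n nb => [|n] nb; last by exists n.+1%:R; split => //; exists b.
  by exists 1; split => //; exists 0 => //; rewrite scaler0 -nb scale0r.
have [l [l0 [c Bc <-]] ld] := inf_lt inf_ds.1 xd.
have [v Vv <-] := BV _ Bc; rewrite scalerA.
apply: (VU (l * s, v)); split => //=; apply: dV.
by rewrite -ball_normE/= sub0r normrN gtr0_norm ?mulr_gt0// -ltr_pdivlMr.
Qed.

End disc_space.

Section hilbert_completion.
Context (R : realType) (Phi : tvsType R) (p : Phi -> R).
Hypothesis p_hilb : hilbertian_seminorm p.
Context (H : completeNormedModType R) (i : {linear Phi -> H}).
Hypothesis i_norm : forall phi, `|i phi| <= p phi.

Lemma seminorm_bounded_continuous : continuous i.
Proof.
have [pc p0 pZ _ _] := p_hilb.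
have pp0 : p 0 = 0 by have := pZ 0 0; rewrite scale0r normr0 mul0r.
move=> x; apply/cvgrPdist_lt => e e0.
have : (fun y => x - y) @ x --> x - x.
  apply: (@continuous_comp _ _ _ (fun y => (x, y)) (fun z : Phi * Phi => z.1 - z.2)).
    by apply: cvg_pair => /=; [exact: cvg_cst|exact: cvg_id].
  exact: sub_continuous.
rewrite subrr => xy.
have /cvgrPdist_lt/(_ _ e0) := cvg_comp _ _ xy (pc 0).
apply: filterS => y /=; rewrite pp0 sub0r normrN => py.
by rewrite -linearB/= (le_lt_trans (i_norm _))// (le_lt_trans (ler_norm _)).
Qed.

Lemma normed_tvs_complete : tvs_complete (H : tvsType R).
Proof.
move=> F FF Fc; apply/cvg_ex/cauchy_cvgP/cauchy_exP => e e0.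
have [A FA Ae] := Fc (ball 0 e) (nbhsx_ballx _ _ e0).
have [x Ax] := filter_ex FA; exists x; apply: filterS FA => y Ay.
have := Ae x y Ax Ay; rewrite -!ball_normE/= sub0r normrN; exact.
Qed.

(** The target of a linear map with dense range is the completion of its
    source for the seminorm that the map pulls back, and this seminorm is
    Hilbertian and separable when the target is a separable Hilbert space. A
    constant sequence of seminorms generates the topology. *)
Lemma completion_of_dense_map (Q : {symmetric H}) (D : nat -> H) :
  inner_product Q -> dense (range i) -> dense (range D) ->
  exists (theta : set_system Phi) (j : {linear_continuous Phi -> H}),
  [/\ countably_hilbertian theta, j =1 i & tvs_completion theta j].
Proof.
move=> QE di dD; pose q phi : R := `|i phi|.
have q_hilb : hilbertian_seminorm q.
  split.
  - move=> x; apply: cvg_norm; exact: seminorm_bounded_continuous.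
  - by move=> phi; exact: normr_ge0.
  - by move=> a phi; rewrite /q linearZ normrZ.
  - by move=> phi psi; rewrite /q linearD ler_normD.
  - have [Q' Q'E] := restrict_form Q i.
    by exists Q' => phi; rewrite Q'E QE// sqr_ge0.
have q_sep : separable_seminorm q.
  exists H, i; split; first by split.
  by exists (range D) => //; exact: card_image_le.
exists (seminorm_nbhs0 (range (fun _ : nat => q))).
exists (HB.pack_for {linear_continuous Phi -> H} (i : Phi -> H)
  (isContinuous.Build _ _ _ seminorm_bounded_continuous)
  (GRing.Linear.class i)).
split => //; first by exists (fun=> q); split => // phi m n _.
split => //; first exact: normed_tvs_complete.
apply/seteqP; split=> U.
  move=> [n [s [e [sq e0 sU]]]]; exists (ball 0 e); first exact: nbhsx_ballx.
  move=> phi; rewrite /= -ball_normE/= sub0r normrN => ie.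
  by apply: sU => /= l; have [_ _ <-] := sq l.
move=> [V /nbhs_ballP[e /= e0 eV] VU].
exists 1%N, (fun=> q), e; split => // [l|phi /(_ ord0) /= qe]; first by exists 0%N.
by apply: VU; apply: eV; rewrite -ball_normE/= sub0r normrN.
Qed.

End hilbert_completion.

(** * Regularization *)

Theorem theorem5p1 (R : realType) (d : measure_display)
    (Omega : measurableType d) (P : probability Omega R)
    (P_complete : measure_is_complete P)
    (Phi Psi : tvsType R) (Psi_multi_hilbertian : multi_hilbertian Psi)
    (k : path_kind)
    (X : R -> Psi -> {mfun_ P, Omega >-> measurableTypeR R})
    (X_cylindrical : cylindrical_process X)
    (X_paths : forall psi : Psi, real_process_of_kind k (fun t => X t psi))
    (X_fourier : forall T : R, 0 < T ->
      fourier_equicontinuous0 X [set t | 0 <= t <= T])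
    (S : {linear Phi -> Psi}) (S_hilbert_schmidt : hilbert_schmidt_operator S) :
  exists theta : set_system Phi, countably_hilbertian theta /\
  exists (E : tvsType R) (j : {linear_continuous Phi -> E}),
    tvs_completion theta j /\
  exists Y : R -> Omega -> strong_dual E,
    [/\ process_of_kind P k Y,
        forall (phi : Phi) (t : R), 0 <= t ->
          (fun w => pairing (Y t w) (j phi)) = X t (S phi) %[ae P],
        regular_version k (fun t phi => X t (S phi))
          (fun t w => adjoint j (Y t w)) &
        forall Z1 Z2 : R -> Omega -> strong_dual Phi,
          regular_version k (fun t phi => X t (S phi)) Z1 ->
          regular_version k (fun t phi => X t (S phi)) Z2 ->
          indistinguishable P Z1 Z2].
Proof.
have [p [B [p_hilb [bB _ _] SB [H [K [ip [jB [S0 [ip_compl discB [QK QKE] SE hsS0]]]]]]]]] :=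
  S_hilbert_schmidt.
have [ipN dip] := ip_compl.
have [E [Q [e [pi [x [C [QE [e_orth e_unit] [pi_norm pi_surj] e_exp [S0_exp xC]]]]]]]] :=
  hilbert_schmidt_factorization hsS0.
have e_le1 i : `|e i| <= 1.
  by have [->|->] := e_unit i; rewrite ?normr0 ?ler01.
have [D dD] := dense_rational_span e_le1 e_exp.
pose i0 phi := pi (ip phi).
have i0_linear : linear i0 by move=> a u v; rewrite /i0 !linearP.
have [i iE] : exists i : {linear Phi -> E}, i =1 i0.
  by exists (HB.pack_for {linear Phi -> E} i0
    (GRing.isLinear.Build _ _ _ _ _ i0_linear)).
have i_norm phi : `|i phi| <= p phi by rewrite iE -ipN pi_norm.
have di : dense (range i).
  apply: dense_rangeP => v r r0; have [h <-] := pi_surj v.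
  have [_ [phi _ <-] hphi] := dense_normP dip h r0.
  exists phi; rewrite iE -linearB; exact: le_lt_trans (pi_norm _) hphi.
have [theta [j [theta_ch jE j_compl]]] :=
  completion_of_dense_map p_hilb i_norm QE di dD.
have p0 : p 0 = 0 by rewrite -ipN linear0 normr0.
have B0 : B 0 by apply: SB; exists 0; rewrite /= ?p0 ?ler01// linear0.
have jBc := disc_space_continuous B0 bB discB.
have W_paths y : exists2 Z : R -> Omega -> R,
    process_of_kind P k (Z : R -> Omega -> R^o) &
    forall t, 0 <= t -> {ae P, forall w, Z t w = X t (jB y) w}.
  by have [Z pZ ZX] := X_paths (jB y); exists Z => // t /ZX/ae_eqE.
have W_linear t a u v : 0 <= t -> {ae P, forall w,
    X t (jB (a *: u + v)) w = a * X t (jB u) w + X t (jB v) w}.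
  by move=> t0; rewrite linearP; exact: cylindrical_linear.
have [y [y_meas y_path y_eq]] := regularized_process_exists QKE
  (fun t v => cylindrical_measurable X t (jB v)) W_linear
  (fun t c r t0 c0 r0 => cylindrical_continuous X_cylindrical X_fourier jBc t0 c0 r0)
  W_paths QE e_orth e_unit xC.
have [r r_cts rE] := riesz_map_continuous QE.
pose Y t w := r (y t w).
have Y_kind : process_of_kind P k Y.
  split=> [t t0|].
    apply: borel_measurable_comp r_cts _.
    by apply: borel_measurable_dist dD _ => v; exact: y_meas.
  by apply: filterS y_path => w; exact: path_comp.
have Y_version phi t : 0 <= t ->
    (fun w => pairing (Y t w) (j phi)) = X t (S phi) %[ae P].
  move=> t0; apply/ae_eqE; rewrite SE.
  apply: filterS (y_eq t (j phi) (S0 (ip phi)) t0 _) => [w|].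
    by rewrite /Y rE.
  by rewrite jE iE; exact: S0_exp.
exists theta; split => //; exists E, j; split => //; exists Y; split => //.
- split.
  + split=> [t t0|].
      exact: (borel_measurable_comp (@adjoint_continuous _ _ _ j) (Y_kind.1 t t0)).
    apply: filterS Y_kind.2 => w Yw.
    exact: (path_comp (@adjoint_continuous _ _ _ j) Yw).
  + move=> t t0; exists theta; split => //; exists E, j; split => //.
    by apply: aeW => w; exists (Y t w).
  + by move=> t phi t0; exact: Y_version.
- move=> Z1 Z2 [[_ p1] r1 v1] [[_ p2] r2 v2].
  apply: indistinguishable_of_ae_eq p1 p2 _ => t t0.
  apply: regular_variable_ext (r1 t t0) (r2 t t0) _ => phi.
  have /ae_eqE h1 := v1 t phi t0; have /ae_eqE h2 := v2 t phi t0.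
  by apply: filterS2 h1 h2 => w -> ->.
Qed.
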